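(* Let $M\subset\mathbb{R}^3$ be a smooth compact surface, diffeomorphic to $S^2$, with positive Gauss curvature everywhere, and invariant under the group of rotations about the $x_3$-axis. Let $\xi\in C^\infty(M)$ satisfy $J\nabla\xi=-X_3$. Let $\Omega\in\mathbb{R}$. If $u(t)$ is a smooth solution on a time interval of $$\frac{\partial u}{\partial t}+\nabla_u u=\Omega\,\chi\,Ju-\nabla p,\qquad \operatorname{div}u=0,$$ and $w=\operatorname{rot}u$, then $$\int_M\xi(x)\,w(t,x)\,dS(x)\quad\text{is independent of }t.$$
   Context: $M$ carries the metric induced from $\mathbb{R}^3$ and $dS$ is surface measure. $\nu$ is the unit outward normal, $\chi(x)=e_3\cdot\nu(x)$ with $e_3=(0,0,1)$; $J:T_xM\to T_xM$ is counterclockwise rotation by $90^\circ$ (orientation given by $\nu$); $\nabla_u$ is the Levi-Civita covariant derivative; $p$ is an unknown scalar function. $X_3$ is the vector field on $M$ generating the $2\pi$-periodic rotation about the $x_3$-axis; since its flow is by isometries, $\operatorname{div}X_3=0$ and a function $\xi$ as in the claim exists. The vorticity $w=\operatorname{rot}u$ is defined by $d\tilde u=w\alpha$, where $\tilde u$ is the 1-form dual to $u$ and $\alpha$ is the area form. *)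

(* Defs.v *)
From HB Require Import structures.
From mathcomp Require Import all_boot all_order all_algebra.
From mathcomp Require Import all_classical all_reals all_analysis.
Set Implicit Arguments.
Unset Strict Implicit.
Unset Printing Implicit Defensive.
Import Order.TTheory GRing.Theory Num.Theory.
Import numFieldNormedType.Exports.
Local Open Scope classical_set_scope.
Local Open Scope ring_scope.

Section Smoothness.
Context {R : realType} {V W : normedModType R}.

(* C^n regularity on a set [U], meant for open [U]. *)
Fixpoint Ck (n : nat) (U : set V) (f : V -> W) : Prop :=
  match n with
  | 0 => forall x, U x -> {for x, continuous f}
  | m.+1 => (forall x, U x -> differentiable f x) /\
            (forall v : V, Ck m U (fun x => 'D_v f x))
  end.

Definition smooth_on_open (U : set V) (f : V -> W) : Prop :=
  forall n : nat, Ck n U f.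

(* Calculus on arbitrary subsets of a normed space (as in Milnor's "Topology
   from the differentiable viewpoint"): a map on [A] is smooth when near each
   point of [A] it is the restriction of a smooth map on an open set. *)
Definition smooth_extension (A : set V) (f : V -> W) (x : V) (F : V -> W) :
    Prop :=
  exists U : set V, [/\ open U, U x, smooth_on_open U F
                     & forall y, U y -> A y -> F y = f y].

Definition smooth_on (A : set V) (f : V -> W) : Prop :=
  forall x, A x -> exists F, smooth_extension A f x F.

(* The differential at [x] of a map [f] on [A], in the direction [v], computed
   with a local smooth extension of [f].  The result does not depend on the
   extension when [v] is tangent to [A] at [x], which is the only case in which
   it is used below. *)
Definition tderive (A : set V) (f : V -> W) (x v : V) : W :=
  'D_v (xget f [set F | smooth_extension A f x F]) x.

End Smoothness.

Definition diffeomorphism {R : realType} {V W : normedModType R}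
    (A : set V) (B : set W) (f : V -> W) : Prop :=
  smooth_on A f /\ (forall x, A x -> B (f x)) /\
  exists g : W -> V,
    [/\ smooth_on B g, forall y, B y -> A (g y),
        forall x, A x -> g (f x) = x & forall y, B y -> f (g y) = y].

Section EuclideanSpace.
Context {R : realType}.
Notation E := 'rV[R]_3.

Definition vec3 (a b c : R) : E := \row_j [:: a; b; c]`_j.

Definition dot (x y : E) : R := \sum_(i < 3) x 0 i * y 0 i.

(* The library norm on ['rV[R]_3] is the sup norm. *)
Definition enorm (x : E) : R := Num.sqrt (dot x x).

Definition cross (x y : E) : E :=
  vec3 (x 0 1 * y 0 2 - x 0 2 * y 0 1)
       (x 0 2 * y 0 0 - x 0 0 * y 0 2)
       (x 0 0 * y 0 1 - x 0 1 * y 0 0).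

Definition basis3 (i : 'I_3) : E := delta_mx 0 i.

Definition e3 : E := vec3 0 0 1.

Definition unit_sphere : set E := [set x | enorm x = 1].

Definition rot3 (theta : R) (x : E) : E :=
  vec3 (cos theta * x 0 0 - sin theta * x 0 1)
       (sin theta * x 0 0 + cos theta * x 0 1)
       (x 0 2).

Definition rotation_invariant (M : set E) : Prop :=
  forall (theta : R) (x : E), M x -> M (rot3 theta x).

(* Infinitesimal generator of the rotation flow. *)
Definition X3 (x : E) : E := derive1 (fun theta : R => rot3 theta x) 0.

Definition smooth_surface (M : set E) : Prop :=
  forall x, M x -> exists (O : set E) (U : set 'rV[R]_2) (psi : 'rV[R]_2 -> E),
    [/\ open O, O x, open U & diffeomorphism U (M `&` O) psi].

Definition tangent (M : set E) (x v : E) : Prop :=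
  exists (gamma : R -> E) (U : set R),
    [/\ open U, U 0, smooth_on_open U gamma, forall s, U s -> M (gamma s)
      & gamma 0 = x /\ derive1 gamma 0 = v].

(* The points in unbounded components of the complement of [M]. *)
Definition exterior (M : set E) : set E :=
  [set y | (~` M) y /\ ~ bounded_set (connected_component (~` M) y)].

Definition unit_outward_normal (M : set E) (nu : E -> E) : Prop :=
  smooth_on M nu /\
  forall x, M x ->
    [/\ enorm (nu x) = 1,
        forall v, tangent M x v -> dot (nu x) v = 0
      & \forall s \near 0^'+, exterior M (x + s *: nu x)].

Section Geometry.
Variables (M : set E) (nu : E -> E).

Definition tproj (x v : E) : E := v - dot v (nu x) *: nu x.

Definition Jrot (x v : E) : E := cross (nu x) v.

Definition area_form (x a b : E) : R := dot (Jrot x a) b.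

Definition chi (x : E) : R := dot e3 (nu x).

(* The tangent vector representing the differential of [f]: as [tproj x] is
   self-adjoint, [dot (grad f x) v = tderive M f x v] for [v] tangent. *)
Definition grad (f : E -> R) (x : E) : E :=
  \row_i tderive M f x (tproj x (basis3 i)).

(* Levi-Civita derivative of the induced metric: tangential part of the
   ambient derivative. *)
Definition covd (u : E -> E) (x v : E) : E := tproj x (tderive M u x v).

(* Trace of [covd u x] on the tangent plane, computed as the trace on
   [R^3] of its extension by 0 on the normal line. *)
Definition divergence (u : E -> E) (x : E) : R :=
  \tr (\matrix_(i < 3) covd u x (tproj x (basis3 i))).

(* Determinant of the differential of the Gauss map on the tangent plane,
   computed as the determinant on [R^3] of its extension by the identity on the
   normal line. *)
Definition gauss_curvature (x : E) : R :=
  \det (\matrix_(i < 3) (tderive M nu x (tproj x (basis3 i)) +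
                         dot (basis3 i) (nu x) *: nu x)).

(* Exterior derivative of the 1-form dual to [u]: locally this form is the
   restriction to [M] of [\sum_i F_i dx_i] with [F] extending [u]. *)
Definition ext_d (u : E -> E) (x a b : E) : R :=
  dot (tderive M u x a) b - dot (tderive M u x b) a.

Definition is_rot (u : E -> E) (w : E -> R) : Prop :=
  forall x, M x -> forall a b, tangent M x a -> tangent M x b ->
    ext_d u x a b = w x * area_form x a b.

End Geometry.

Definition sphere_param (theta lambda : R) : E :=
  vec3 (sin theta * cos lambda) (sin theta * sin lambda) (cos theta).

(* Integral for the surface measure of the image of the sphere under a
   diffeomorphism [phi], in the parametrization [phi \o sphere_param], which is
   injective and regular on the open rectangle and misses only an arc.  By the
   change of variables formula only the image surface matters, not [phi]. *)
Definition surface_integral (phi : E -> E) (f : E -> R) : R :=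
  let psi theta lambda := phi (sphere_param theta lambda) in
  \int[lebesgue_measure]_(theta in `[0, pi])
    \int[lebesgue_measure]_(lambda in `[0, 2 * pi])
      (f (psi theta lambda) *
       enorm (cross (derive1 (psi ^~ lambda) theta) (derive1 (psi theta) lambda))).

(* Derivative in time, one-sided at the endpoints of [I]. *)
Definition time_derive (I : interval R) (M : set E) (u : R -> E -> E)
    (t : R) (x : E) : E :=
  tderive ([set` I] `*` M) (fun z : R * E => u z.1 z.2) (t, x) (1, 0).

(* Velocity fields, smooth jointly in time and space, that solve the Euler
   equation on [M] with Coriolis parameter [Omega] and pressure [p]. *)
Definition euler_solution (M : set E) (nu : E -> E) (Omega : R)
    (I : interval R) (u : R -> E -> E) (p : R -> E -> R) : Prop :=
  [/\ smooth_on ([set` I] `*` M) (fun z : R * E => u z.1 z.2),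
      forall t, t \in I -> smooth_on M (p t),
      forall t x, t \in I -> M x -> tangent M x (u t x),
      forall t x, t \in I -> M x ->
        time_derive I M u t x + covd M nu (u t) x (u t x) =
        (Omega * chi nu x) *: Jrot nu x (u t x) - grad M nu (p t) x
    & forall t x, t \in I -> M x -> divergence M nu (u t) x = 0].

End EuclideanSpace.

(* Main.v *)
Require Import Defs.
From HB Require Import structures.
From mathcomp Require Import all_boot all_order all_algebra.
From mathcomp Require Import all_classical all_reals all_analysis.
From mathcomp Require Import ring lra.
Import Order.TTheory GRing.Theory Num.Theory.
Import numFieldNormedType.Exports.
Local Open Scope classical_set_scope.
Local Open Scope ring_scope.
Set Implicit Arguments.
Unset Strict Implicit.
Unset Printing Implicit Defensive.

(** Why the statement holds.  Let X be the rotation field [X3], alpha the area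
    form and u~ the 1-form dual to u.  The hypothesis on xi says that d xi is
    the contraction of alpha with X ([grad_xi]).  Hence

      d (xi u~) = xi w alpha - <u, X> alpha        ([vorticity_exact])

    and by Stokes on the closed surface M the integral of xi w is the integral
    of <u, X>, the angular momentum about the third axis
    ([vorticity_integral]).  Pairing the Euler equation with X shows that the
    time derivative of that density is exact as well ([euler_exact]):

      <du/dt, X> alpha = d ((- <u, X> + Omega r^2 / 2) i_u alpha - p d xi),

    where r is the distance to the axis.  Here i_u alpha is closed since
    div u = 0 ([flux_divergence]); the advection term gives the derivative of
    <u, X> along u because X generates isometries, so that <u, D_u X> = 0; the
    pressure term <grad p, X> alpha is dp /\ d xi; and for a surface of
    revolution chi <J u, X> is the derivative of r^2 / 2 along u
    ([coriolis_identity]), which gives the Coriolis term an explicit primitive.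
    Integrating, the angular momentum is constant ([momentum_conserved]).

    Stokes is carried out in polar coordinates: M is parametrized by the
    rectangle of colatitudes and longitudes, the area element is up to a
    constant sign the smooth function [jac] ([jac_sign]), and for a pulled-back
    1-form P d theta + Q d lambda the boundary terms cancel since P is periodic
    in lambda and Q vanishes at the poles ([stokes_rectangle]).

    Derivatives on M are derivatives of arbitrary local extensions.  They are
    only ever taken along maps with values in M, where the chain rule makes the
    choice of extension irrelevant ([tderive_comp]).  The same device handles
    time: composing with a smooth function [interp] from the line to the time
    interval, which joins the two given instants, makes everything smooth on
    the whole line, end points of the interval included. *)

Local Notation smooth f := (smooth_on_open [set: _] f).

(** * Iterated directional derivatives on an open set *)

Section CkTheory.
Context {R : realType}.
Implicit Types V W Z : normedModType R.

Lemma CkW n V W (U : set V) (f : V -> W) : Ck n.+1 U f -> Ck n U f.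
Proof.
elim: n f => [|n IH] f /= [df Df]; first by move=> x /df /differentiable_continuous.
by split=> // v; apply: IH; exact: Df.
Qed.

(** Smooth extensions exist only near each point; this transfers their
    regularity to maps defined everywhere. *)
Lemma Ck_local n V W (U : set V) (f : V -> W) :
  (forall x, U x -> exists U', [/\ open U', U' x & Ck n U' f]) -> Ck n U f.
Proof.
elim: n f => [|n IH] f loc /=.
  by move=> x /loc [U' [_ U'x]]; apply.
split=> [x /loc [U' [_ U'x [+ _]]]|v]; first exact.
by apply: IH => x /loc [U' [oU' U'x [_ /(_ v)]]]; exists U'.
Qed.

Lemma CkS n V W (U U' : set V) (f : V -> W) : U' `<=` U -> Ck n U f -> Ck n U' f.
Proof.
move=> sub; elim: n f => [|n IH] f /=; first by move=> + x /sub; apply.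
by move=> [df Df]; split=> [x /sub|v]; [exact: df|exact: IH].
Qed.

(** The difference vanishes near [x], so it is differentiable there with zero
    differential. *)
Lemma eq_differentiable V W (f g : V -> W) (x : V) :
  {near x, f =1 g} -> differentiable f x -> differentiable g x.
Proof.
move=> fg df.
have -> : g = f + (g - f) by rewrite addrC subrK.
apply: differentiableD => //.
have fg0 : \forall y \near (0 : V), f (y + x) = g (y + x).
  by move: fg; rewrite (near_shift 0); apply: filterS => y /=; rewrite subr0.
have h0 : (g - f) \o shift x =
    cst ((g - f) x) + (0 : V -> W) +o_ (0 : V) id.
  apply/eqaddoP => e e0; near=> y.
  rewrite /= !fctE/= !addr0.
  rewrite (nbhs_singleton fg) subrr subr0.
  have -> : f (y + x) = g (y + x) by near: y.
  by rewrite subrr normr0 mulr_ge0// ltW.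
have d0 : 'd (g - f) x = (0 : V -> W) :> (V -> W).
  apply: (@diff_unique _ _ _ _ (\0 : {linear V -> W})) => //.
  exact: cst_continuous.
apply/diff_locallyP; rewrite d0; split=> //; exact: cst_continuous.
Unshelve. all: by end_near. Qed.

Lemma eq_Ck n V W (U : set V) (f g : V -> W) : open U ->
  (forall x, U x -> f x = g x) -> Ck n U f -> Ck n U g.
Proof.
move=> oU; elim: n f g => [|n IH] f g fg cf.
  move=> x Ux; have := cf x Ux; rewrite /prop_for /continuous_at (fg _ Ux).
  apply: cvg_trans; apply: near_eq_cvg.
  by have := open_nbhs_nbhs (conj oU Ux); apply: filterS => y /fg ->.
have nfg x : U x -> {near x, f =1 g}.
  by move=> Ux; have := open_nbhs_nbhs (conj oU Ux); apply: filterS => y /fg.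
have [df Df] := cf; split=> [x Ux|v].
  exact: eq_differentiable (nfg _ Ux) (df _ Ux).
by apply: (IH ('D_v f)) (Df v) => x Ux; apply: near_eq_derive; exact: nfg.
Qed.

Lemma Ck_cst n V W (U : set V) (a : W) : Ck n U (fun=> a).
Proof.
elim: n a => [|n IH] a; first by move=> x _; exact: cvg_cst.
split=> [x _|v]; first exact: differentiable_cst.
by have -> : 'D_v (fun=> a : W) = (fun=> 0); [apply/funext => x; exact: derive_cst|exact: IH].
Qed.

Lemma Ck_add n V W (U : set V) (f g : V -> W) : open U ->
  Ck n U f -> Ck n U g -> Ck n U (fun x => f x + g x).
Proof.
move=> oU; elim: n f g => [|n IH] f g.
  by move=> cf cg x Ux; apply: cvgD; [exact: cf|exact: cg].
move=> [df Df] [dg Dg]; split=> [x Ux|v].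
  by apply: differentiableD; [exact: df|exact: dg].
apply: (@eq_Ck _ _ _ _ (fun x => 'D_v f x + 'D_v g x)) => //.
  by move=> x Ux; rewrite -deriveD//; apply: diff_derivable; [exact: df|exact: dg].
by apply: IH; [exact: Df|exact: Dg].
Qed.

Lemma Ck_sum n V W (U : set V) (I : finType) (f : I -> V -> W) : open U ->
  (forall i, Ck n U (f i)) -> Ck n U (fun x => \sum_i f i x).
Proof.
move=> oU cf; elim: (index_enum I) => [|i r IH].
  by under eq_fun do rewrite big_nil; exact: Ck_cst.
by under eq_fun do rewrite big_cons; exact: Ck_add.
Qed.

Lemma derive_comp V W Z (f : V -> W) (g : W -> Z) x v :
  differentiable f x -> differentiable g (f x) ->
  'D_v (g \o f) x = 'D_('D_v f x) g (f x).
Proof.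
move=> df dg; rewrite !deriveE//; last exact: differentiable_comp.
by rewrite diff_comp.
Qed.

Lemma derive_pair V W Z (f : V -> W) (g : V -> Z) x v :
  differentiable f x -> differentiable g x ->
  'D_v (fun y => (f y, g y)) x = ('D_v f x, 'D_v g x).
Proof.
move=> df dg; rewrite deriveE; last exact: differentiable_pair.
by rewrite diff_pair//= !deriveE.
Qed.

Lemma derive_linear V W (f : {linear V -> W}) x v : continuous f ->
  'D_v f x = f v.
Proof.
move=> cf; rewrite deriveE; last exact: linear_differentiable.
by rewrite diff_lin.
Qed.

Lemma Ck_linear n V W Z (U : set V) (f : V -> W) (c : {linear W -> Z}) :
  open U -> continuous c -> Ck n U f -> Ck n U (c \o f).
Proof.
move=> oU cc; elim: n f => [|n IH] f.
  by move=> cf x Ux; apply: continuous_comp; [exact: cf|exact: cc].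
have dc x : differentiable c x by exact: linear_differentiable.
move=> [df Df]; split=> [x Ux|v]; first by apply: differentiable_comp => //; exact: df.
apply: (@eq_Ck _ _ _ _ (c \o 'D_v f)) => //; last exact: IH (Df v).
by move=> x Ux; rewrite derive_comp//; [rewrite derive_linear|exact: df].
Qed.

Lemma Ck_id n V (U : set V) : Ck n U (@idfun V).
Proof.
case: n => [|n]; first by move=> x _; exact: cvg_id.
split=> [x _|v]; first by apply: (@linear_differentiable _ _ _ idfun) => y; exact: cvg_id.
have -> : 'D_v (@idfun V) = (fun=> v) by apply/funext => x; exact: derive_id.
exact: Ck_cst.
Qed.

Lemma derive_bilinear V W W' Z (B : {bilinear W -> W' -> Z})
    (f : V -> W) (g : V -> W') x v :
  continuous (fun p => B p.1 p.2) -> differentiable f x -> differentiable g x ->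
  differentiable (fun y => B (f y) (g y)) x /\
  'D_v (fun y => B (f y) (g y)) x = B ('D_v f x) (g x) + B (f x) ('D_v g x).
Proof.
move=> cB df dg.
have dB p : differentiable (fun p => B p.1 p.2) p by exact: differentiable_bilin.
have dfg : differentiable (fun y => (f y, g y)) x by exact: differentiable_pair.
have dBfg : differentiable (fun y => B (f y) (g y)) x.
  exact: (@differentiable_comp _ _ _ _ (fun y => (f y, g y)) (fun p => B p.1 p.2)).
split=> //; rewrite deriveE//.
rewrite (@diff_comp _ _ _ _ (fun y => (f y, g y)) (fun p => B p.1 p.2))//=.
by rewrite diff_bilin// diff_pair//= !deriveE// addrC.
Qed.

(** Leibniz rule: a derivative of [B f g] is again a sum of bilinear
    expressions, of one order less.  Scaling, dot and cross products are all
    instances. *)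
Lemma Ck_bilinear n V W W' Z (B : {bilinear W -> W' -> Z}) (U : set V)
    (f : V -> W) (g : V -> W') :
  open U -> continuous (fun p => B p.1 p.2) ->
  Ck n U f -> Ck n U g -> Ck n U (fun y => B (f y) (g y)).
Proof.
move=> oU cB; elim: n f g => [|n IH] f g.
  move=> cf cg x Ux.
  apply: (@continuous_comp _ _ _ (fun y => (f y, g y)) (fun p => B p.1 p.2)).
    by apply: cvg_pair; [exact: cf|exact: cg].
  exact: cB.
move=> Cf Cg; have [df Df] := Cf; have [dg Dg] := Cg.
split=> [x Ux|v].
  by have [] := derive_bilinear 0 cB (df _ Ux) (dg _ Ux).
apply: (@eq_Ck _ _ _ _ (fun x => B ('D_v f x) (g x) + B (f x) ('D_v g x))) => //.
  by move=> x Ux; have [_ ->] := derive_bilinear v cB (df _ Ux) (dg _ Ux).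
apply: Ck_add => //; apply: IH => //; [exact: Df|exact: CkW|exact: CkW|exact: Dg].
Qed.

Lemma scale_is_bilinear W : bilinear_for
    (GRing.Scale.Law.clone _ _ *:%R _) (GRing.Scale.Law.clone _ _ *:%R _)
    (fun (a : R) (w : W) => a *: w).
Proof.
split=> [w|a] b x y /=; first by rewrite scalerDl scalerA.
by rewrite scalerDr !scalerA mulrC.
Qed.

Lemma Ck_scale n V W (U : set V) (f : V -> R) (g : V -> W) : open U ->
  Ck n U f -> Ck n U g -> Ck n U (fun y => f y *: g y).
Proof.
pose H := bilinear_isBilinear.Build R R W W _ _ _ (@scale_is_bilinear W).
pose B : {bilinear R -> W -> W} := HB.pack (fun (a : R) (w : W) => a *: w) H.
move=> oU; apply: (@Ck_bilinear _ _ _ _ _ B) => //.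
exact: scale_continuous.
Qed.

(** A finite family of vectors with continuous coordinate functionals:
    directional derivatives in a variable direction become finite sums of
    directional derivatives in fixed ones, which is what the induction for
    composite maps needs. *)
Definition findim W := exists (I : finType) (e : I -> W) (c : I -> {linear W -> R}),
  (forall i, continuous (c i)) /\ (forall v, v = \sum_i c i v *: e i).

(** The chain rule gives ['D_v (g \o f) = 'D_('D_v f) g \o f], where the
    direction moves with the point; expanding it on a basis makes every term a
    product to which the induction hypothesis applies. *)
Lemma Ck_comp n V W Z (U : set V) (U' : set W) (f : V -> W) (g : W -> Z) :
  findim W -> open U -> (forall x, U x -> U' (f x)) ->
  Ck n U f -> Ck n U' g -> Ck n U (g \o f).
Proof.
move=> [I [e [c [cc ce]]]] oU UU'; elim: n f UU' g => [|n IH] f UU' g Cf Cg.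
  by move=> x Ux; apply: continuous_comp; [exact: Cf|apply: Cg; exact: UU'].
have [df Df] := Cf; have [dg Dg] := Cg.
split=> [x Ux|v]; first by apply: differentiable_comp; [exact: df|apply: dg; exact: UU'].
apply: (@eq_Ck _ _ _ _ (fun x => \sum_i c i ('D_v f x) *: ('D_(e i) g \o f) x)) => //.
  move=> x Ux.
  have dgfx : differentiable g (f x) by apply: dg; exact: UU'.
  rewrite derive_comp//; last exact: df.
  rewrite [RHS]deriveE// [in RHS](ce ('D_v f x)) linear_sum.
  by apply: eq_bigr => i _; rewrite linearZ/= -(deriveE _ dgfx).
apply: Ck_sum => // i; apply: Ck_scale => //; first exact: (@Ck_linear _ _ _ _ _ _ (c i) oU (cc i) (Df v)).
by apply: IH => //; [exact: CkW|exact: Dg].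
Qed.

End CkTheory.

(** * Finite-dimensional normed spaces *)

Section FinDim.
Context {R : realType}.

Lemma findim_scalar : findim (R : normedModType R).
Proof.
exists unit, (fun=> 1), (fun=> idfun); split=> [_ x|v]; first exact: cvg_id.
rewrite (eq_bigr (fun=> v)) => [|i _]; last exact: mulr1.
by rewrite sumr_const card_unit.
Qed.

Definition coordf n (i : 'I_n) (x : 'rV[R]_n) : R := x 0 i.
Lemma coordf_is_linear n i : linear (@coordf n i).
Proof. by move=> a x y; rewrite /coordf !mxE. Qed.
HB.instance Definition _ n i :=
  GRing.isLinear.Build R 'rV[R]_n R *:%R (@coordf n i) (coordf_is_linear i).

Lemma coordf_continuous n (i : 'I_n) : continuous (@coordf n i).
Proof. exact: coord_continuous. Qed.

Lemma findim_rV n : findim ('rV[R]_n : normedModType R).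
Proof.
exists 'I_n, (fun i => delta_mx 0 i), (fun i => @coordf n i : {linear _ -> _}).
split=> [i|v]; [exact: coordf_continuous|exact: row_sum_delta].
Qed.

Lemma findim_prod (V W : normedModType R) :
  findim V -> findim W -> findim (V * W)%type.
Proof.
move=> [I [e [c [cc ce]]]] [J [e' [c' [cc' ce']]]].
exists (I + J)%type.
exists (fun k => match k with inl i => (e i, 0) | inr j => (0, e' j) end).
exists (fun k => match k with inl i => (c i \o fst : {linear _ -> _})
  | inr j => (c' j \o snd : {linear _ -> _}) end).
split=> [[i|j] x|[v w]].
- by apply: continuous_comp; [exact: cvg_fst|exact: cc].
- by apply: continuous_comp; [exact: cvg_snd|exact: cc'].
rewrite big_sumType/=.
have -> : \sum_i c i v *: ((e i, 0) : V * W) = (v, 0).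
  apply/esym; rewrite {1}(ce v).
  by apply: (big_ind2 (fun a b => (a, 0) = b)) => [//|x1 x2 y1 y2 <- <-|i _];
    congr (_, _); rewrite /= ?addr0 ?scaler0.
have -> : \sum_j c' j w *: ((0, e' j) : V * W) = (0, w).
  apply/esym; rewrite {1}(ce' w).
  by apply: (big_ind2 (fun a b => (0, a) = b)) => [//|x1 x2 y1 y2 <- <-|i _];
    congr (_, _); rewrite /= ?addr0 ?scaler0.
by congr (_, _); rewrite /= ?addr0 ?add0r.
Qed.
End FinDim.

(** * Smooth maps into a subset and the chain rule for [tderive] *)

Section Smooth.
Context {R : realType}.
Implicit Types V W Z : normedModType R.

Lemma smooth_derive V W (f : V -> W) v : smooth f -> smooth ('D_v f).
Proof. by move=> sf n; have [_] := sf n.+1; apply. Qed.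

Lemma smooth_differentiable V W (f : V -> W) x : smooth f -> differentiable f x.
Proof. by move=> sf; have [+ _] := sf 1%N; apply. Qed.

Lemma smooth_continuous V W (f : V -> W) : smooth f -> continuous f.
Proof. by move=> sf x; apply: (sf 0%N). Qed.

(** Near each point [f] may be replaced by a smooth extension, since [sigma]
    never leaves [A]. *)
Lemma smooth_on_comp V W Z (A : set W) (f : W -> Z) (sigma : V -> W) :
  findim W -> smooth sigma -> (forall x, A (sigma x)) -> smooth_on A f ->
  smooth (f \o sigma).
Proof.
move=> fW ss As sf n; apply: Ck_local => x _.
have [F [U [oU Us sF Ff]]] := sf _ (As x).
have oU' : open (sigma @^-1` U).
  by apply: open_comp => // y _; exact: smooth_continuous.
exists (sigma @^-1` U); split=> //.
apply: (@eq_Ck _ _ _ _ _ (F \o sigma)) => // [y Uy|]; first exact: Ff.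
by apply: (@Ck_comp _ _ _ _ _ _ U) => //; apply: (CkS _ (ss n)).
Qed.

(** Along a map with values in [A] any two extensions of [f] agree, so the
    chain rule holds for the extension that [tderive] happens to choose.  This
    is the only way in which values of [tderive] are computed. *)
Lemma tderive_comp V W Z (A : set W) (f : W -> Z) (sigma : V -> W) x v :
  differentiable sigma x -> (forall y, A (sigma y)) -> smooth_on A f ->
  'D_v (f \o sigma) x = tderive A f (sigma x) ('D_v sigma x).
Proof.
move=> ds As sf; rewrite /tderive.
have [U [oU Us sF Ff]] := xgetPex f (sf _ (As x)).
set F := xget _ _ in sF Ff *.
have dF : differentiable F (sigma x) by have [+ _] := sF 1%N; apply.
rewrite -derive_comp//; apply: near_eq_derive.
have : \forall y \near x, U (sigma y).
  by apply: differentiable_continuous => //; exact: open_nbhs_nbhs.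
by apply: filterS => y Uy; rewrite /= Ff.
Qed.

(** [tderive A f x] is the differential of a single extension, the same for all
    directions. *)
Lemma tderive_linear W Z (A : set W) (f : W -> Z) x :
  A x -> smooth_on A f -> exists L : {linear W -> Z}, tderive A f x =1 L.
Proof.
move=> Ax sf; have [U [_ Ux sF _]] := xgetPex f (sf _ Ax).
exists ('d (xget f [set F | smooth_extension A f x F]) x) => v.
by rewrite /tderive deriveE//; have [+ _] := sF 1%N; apply.
Qed.

End Smooth.

(** * The algebra of smooth maps *)

Section SmoothAlgebra.
Context {R : realType}.
Implicit Types V W Z : normedModType R.

Lemma smooth_cst V W (a : W) : smooth (fun _ : V => a).
Proof. by move=> n; exact: Ck_cst. Qed.

Lemma smooth_add V W (f g : V -> W) :
  smooth f -> smooth g -> smooth (fun x => f x + g x).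
Proof. by move=> sf sg n; apply: Ck_add => //; exact: openT. Qed.

Lemma smooth_linear V W Z (f : V -> W) (c : {linear W -> Z}) :
  continuous c -> smooth f -> smooth (fun x => c (f x)).
Proof. by move=> cc sf n; apply: (@Ck_linear _ n _ _ _ _ f c) => //; exact: openT. Qed.

Lemma smooth_id V : smooth (@idfun V).
Proof. by move=> n; exact: Ck_id. Qed.

Lemma smooth_scale V W (f : V -> R) (g : V -> W) :
  smooth f -> smooth g -> smooth (fun x => f x *: g x).
Proof. by move=> sf sg n; apply: Ck_scale => //; exact: openT. Qed.

Lemma smooth_mul V (f g : V -> R) :
  smooth f -> smooth g -> smooth (fun x => f x * g x).
Proof. exact: smooth_scale. Qed.

Lemma smooth_opp V W (f : V -> W) : smooth f -> smooth (fun x => - f x).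
Proof.
move=> sf; have -> : (fun x => - f x) = (fun x => (-1 : R) *: f x).
  by apply/funext => x; rewrite scaleN1r.
by apply: smooth_scale => //; exact: smooth_cst.
Qed.

Lemma smooth_sub V W (f g : V -> W) :
  smooth f -> smooth g -> smooth (fun x => f x - g x).
Proof. by move=> sf sg; apply: smooth_add => //; exact: smooth_opp. Qed.

Lemma smooth_pair V W Z (f : V -> W) (g : V -> Z) :
  smooth f -> smooth g -> smooth (fun x => (f x, g x)).
Proof.
move=> sf sg n; elim: n f g sf sg => [|n IH] f g sf sg.
  by move=> x _; apply: cvg_pair; [exact: (smooth_continuous sf)|exact: (smooth_continuous sg)].
have df x := smooth_differentiable x sf.
have dg x := smooth_differentiable x sg.
split=> [x _|v]; first exact: differentiable_pair.
have -> : 'D_v (fun x => (f x, g x)) = (fun x => ('D_v f x, 'D_v g x)).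
  by apply/funext => x; exact: derive_pair.
by apply: IH; exact: smooth_derive.
Qed.

Lemma smooth_comp V W Z (f : V -> W) (g : W -> Z) :
  findim W -> smooth f -> smooth g -> smooth (g \o f).
Proof.
by move=> fW sf sg n; apply: (@Ck_comp _ _ _ _ _ _ setT) => //; exact: openT.
Qed.

Lemma deriveZ1 W (f : R -> W) v x : differentiable f x -> 'D_v f x = v *: 'D_1 f x.
Proof.
by move=> df; rewrite !deriveE// -linearZ /= -[v in LHS](mulr1 v).
Qed.

(** Simultaneous induction, as each function is up to sign the derivative of
    the other. *)
Lemma smooth_trig : smooth (@sin R) /\ smooth (@cos R).
Proof.
have dsin x : differentiable (@sin R) x by apply/derivable1_diffP; exact: derivable_sin.
have dcos x : differentiable (@cos R) x by apply/derivable1_diffP; exact: derivable_cos.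
suff H n : Ck n setT (@sin R) /\ Ck n setT (@cos R) by split=> n; have [] := H n.
elim: n => [|n [IHs IHc]].
  by split=> x _; [exact: continuous_sin|exact: continuous_cos].
split; split=> // v.
  have -> : 'D_v (@sin R) = (fun x => v *: cos x).
    by apply/funext => x; rewrite deriveZ1// derive_val.
  by apply: Ck_scale => //; [exact: openT|exact: Ck_cst].
have -> : 'D_v (@cos R) = (fun x => (- v) *: sin x).
  by apply/funext => x; rewrite deriveZ1// derive_val scalerN scaleNr.
by apply: Ck_scale => //; [exact: openT|exact: Ck_cst].
Qed.

Lemma derive_mul V (f g : V -> R) x v : smooth f -> smooth g ->
  'D_v (fun y => f y * g y) x = 'D_v f x * g x + f x * 'D_v g x.
Proof.
move=> sf sg.
have := @deriveM _ _ f g x v.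
rewrite /= => ->; first by rewrite addrC; congr (_ + _); rewrite -[LHS]/(g x * _) mulrC.
all: by apply: diff_derivable; exact: smooth_differentiable.
Qed.

Lemma derive_add V W (f g : V -> W) x v : smooth f -> smooth g ->
  'D_v (fun y => f y + g y) x = 'D_v f x + 'D_v g x.
Proof.
by move=> sf sg; rewrite -deriveD//; apply: diff_derivable; exact: smooth_differentiable.
Qed.

Lemma derive_sub V W (f g : V -> W) x v : smooth f -> smooth g ->
  'D_v (fun y => f y - g y) x = 'D_v f x - 'D_v g x.
Proof.
by move=> sf sg; rewrite -deriveB//; apply: diff_derivable; exact: smooth_differentiable.
Qed.

End SmoothAlgebra.

(** * Dot and cross products *)

Section Euclid.
Context {R : realType}.
Notation E := 'rV[R]_3.

Lemma ord3P (P : 'I_3 -> Prop) : P 0 -> P 1 -> P 2 -> forall i, P i.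
Proof.
move=> P0 P1 P2 [[|[|[|//]]] lt]; first by rewrite (_ : Ordinal _ = 0)//; exact/val_inj.
- by rewrite (_ : Ordinal _ = 1)//; exact/val_inj.
- by rewrite (_ : Ordinal _ = 2)//; exact/val_inj.
Qed.

Lemma sum3 (V : zmodType) (F : 'I_3 -> V) : \sum_i F i = F 0 + F 1 + F 2.
Proof.
rewrite !big_ord_recr big_ord0 /= add0r.
by congr (F _ + F _ + F _); exact/val_inj.
Qed.

Lemma dotE (x y : E) :
  dot x y = x 0 0 * y 0 0 + x 0 1 * y 0 1 + x 0 2 * y 0 2.
Proof. exact: sum3. Qed.

Lemma vec3E (a b c : R) :
  (vec3 a b c 0 0 = a) * (vec3 a b c 0 1 = b) * (vec3 a b c 0 2 = c).
Proof. by rewrite /vec3 !mxE. Qed.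

Lemma vecP (x y : E) : x 0 0 = y 0 0 -> x 0 1 = y 0 1 -> x 0 2 = y 0 2 -> x = y.
Proof. by move=> x0 x1 x2; apply/rowP; exact: ord3P. Qed.

Lemma vec3_basis (a b c : R) :
  vec3 a b c = a *: basis3 0 + b *: basis3 1 + c *: basis3 2.
Proof.
by apply: vecP; rewrite vec3E /basis3 !mxE /= !(mulr1, mulr0, addr0, add0r).
Qed.

Lemma dot_is_bilinear : bilinear_for
    (GRing.Scale.Law.clone _ _ *:%R _) (GRing.Scale.Law.clone _ _ *:%R _)
    (@dot R).
Proof.
split=> [w|w] b x y /=; rewrite !dotE !mxE -[_ *: _ in RHS]/(_ * _); ring.
Qed.
HB.instance Definition _ :=
  bilinear_isBilinear.Build R E E R _ _ (@dot R) dot_is_bilinear.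

Lemma cross_is_bilinear : bilinear_for
    (GRing.Scale.Law.clone _ _ *:%R _) (GRing.Scale.Law.clone _ _ *:%R _)
    (@cross R).
Proof.
by split=> [w|w] b x y /=; rewrite /cross; apply: vecP; rewrite !mxE /= ?mxE; ring.
Qed.
HB.instance Definition _ :=
  bilinear_isBilinear.Build R E E E _ _ (@cross R) cross_is_bilinear.

Section SmoothE.
Variable V : normedModType R.

Lemma smooth_coord (f : V -> E) (i : 'I_3) : smooth f -> smooth (fun x => f x 0 i).
Proof. exact: (@smooth_linear _ _ _ _ f (@coordf R 3 i) (@coordf_continuous _ _ i)). Qed.

Lemma derive_coord (f : V -> E) (i : 'I_3) x v : smooth f ->
  'D_v (fun x => f x 0 i) x = ('D_v f x) 0 i.
Proof.
move=> sf; have dc y : differentiable (@coordf R 3 i) y.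
  by apply: linear_differentiable; exact: coordf_continuous.
rewrite [LHS](@derive_comp _ _ _ _ f (@coordf R 3 i))//; last exact: smooth_differentiable.
rewrite derive_linear//; exact: coordf_continuous.
Qed.

Lemma smooth_vec3 (a b c : V -> R) : smooth a -> smooth b -> smooth c ->
  smooth (fun x => vec3 (a x) (b x) (c x)).
Proof.
move=> sa sb sc; under eq_fun do rewrite vec3_basis.
by do 2?apply: smooth_add; apply: smooth_scale => //; exact: smooth_cst.
Qed.

Lemma smooth_dot (f g : V -> E) :
  smooth f -> smooth g -> smooth (fun x => dot (f x) (g x)).
Proof.
move=> sf sg; under eq_fun do rewrite dotE.
by do 2?apply: smooth_add; apply: smooth_mul; exact: smooth_coord.
Qed.

Lemma smooth_cross (f g : V -> E) :
  smooth f -> smooth g -> smooth (fun x => cross (f x) (g x)).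
Proof.
by move=> sf sg; apply: smooth_vec3; apply: smooth_sub; apply: smooth_mul; exact: smooth_coord.
Qed.
End SmoothE.

Lemma smooth_fst (V W : normedModType R) : smooth (fun x : V * W => x.1).
Proof.
apply: (@smooth_linear _ _ _ _ (@idfun (V * W)%type) (fst : {linear _ -> _})).
- by move=> x; exact: cvg_fst.
- exact: smooth_id.
Qed.

Lemma smooth_snd (V W : normedModType R) : smooth (fun x : V * W => x.2).
Proof.
apply: (@smooth_linear _ _ _ _ (@idfun (V * W)%type) (snd : {linear _ -> _})).
- by move=> x; exact: cvg_snd.
- exact: smooth_id.
Qed.

Lemma dot_continuous : continuous (fun p : E * E => dot p.1 p.2).
Proof. by apply: smooth_continuous; apply: smooth_dot; [exact: smooth_fst|exact: smooth_snd]. Qed.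

Lemma cross_continuous : continuous (fun p : E * E => cross p.1 p.2).
Proof. by apply: smooth_continuous; apply: smooth_cross; [exact: smooth_fst|exact: smooth_snd]. Qed.

Lemma derive_dot (V : normedModType R) (f g : V -> E) x v : smooth f -> smooth g ->
  'D_v (fun y => dot (f y) (g y)) x = dot ('D_v f x) (g x) + dot (f x) ('D_v g x).
Proof.
move=> sf sg; have [_] := @derive_bilinear _ _ _ _ _ (@dot R) f g x v
  dot_continuous (smooth_differentiable x sf) (smooth_differentiable x sg).
exact.
Qed.

Lemma derive_cross (V : normedModType R) (f g : V -> E) x v : smooth f -> smooth g ->
  'D_v (fun y => cross (f y) (g y)) x = cross ('D_v f x) (g x) + cross (f x) ('D_v g x).
Proof.
move=> sf sg; have [_] := @derive_bilinear _ _ _ _ _ (@cross R) f g x v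
  cross_continuous (smooth_differentiable x sf) (smooth_differentiable x sg).
exact.
Qed.

End Euclid.

(** * Integrals with a parameter, Stokes on a rectangle, mixed partial derivatives *)

Section ParamIntegral.
Context {R : realType}.
Notation mu := (@lebesgue_measure R).

Lemma continuous_itv_integrable (f : R -> R) a b : continuous f ->
  mu.-integrable `[a, b] (EFin \o f).
Proof.
move=> cf; apply: continuous_compact_integrable; first exact: segment_compact.
exact: continuous_subspaceT.
Qed.

(** The tube lemma: continuity in the parameter is uniform over the compact
    interval. *)
Lemma near_uniform_itv (P : normedModType R) (f : P * R -> R) (a b : R) p e :
  continuous f -> 0 < e ->
  \forall q \near p, forall y, `[a, b]%classic y -> `|f (p, y) - f (q, y)| < e.
Proof.
move=> cf e0.
have := @segment_compact _ a b; rewrite compact_near_coveringP => cK.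
apply: (cK _ (nbhs p) (fun q y => `|f (p, y) - f (q, y)| < e)) => y _.
have cfst : (fun z : R * P => f (z.2, z.1)) @ (y, p) --> f (p, y).
  apply: (@continuous_comp _ _ _ (fun z : R * P => (z.2, z.1)) f (y, p)); last exact: cf.
  exact: (smooth_continuous (smooth_pair (@smooth_snd _ _ _) (@smooth_fst _ _ _))).
have cp : (fun z : R * P => f (p, z.1)) @ (y, p) --> f (p, y).
  apply: (@continuous_comp _ _ _ (fun z : R * P => (p, z.1)) f (y, p)); last exact: cf.
  by apply: smooth_continuous; apply: smooth_pair; [exact: smooth_cst|exact: smooth_fst].
have cB : (fun z : R * P => f (p, z.1) - f (z.2, z.1)) @ nbhs (y, p) --> (0 : R).
  by rewrite -(subrr (f (p, y))); exact: cvgB.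
have /cvgrPdist_lt/(_ e e0) := cB; apply: filterS => -[y' q] /=.
by rewrite sub0r normrN.
Qed.

Lemma slice_continuous (P Q : normedModType R) (f : P * R -> Q) p :
  continuous f -> continuous (fun y => f (p, y)).
Proof.
move=> cf y; apply: (@continuous_comp _ _ _ (fun y => (p, y)) f); last exact: cf.
by apply: smooth_continuous; apply: smooth_pair; [exact: smooth_cst|exact: smooth_id].
Qed.

Lemma param_integral_continuous (P : normedModType R) (f : P * R -> R) a b :
  a <= b -> continuous f ->
  continuous (fun p => \int[mu]_(y in `[a, b]) f (p, y)).
Proof.
move=> ab cf p; apply/cvgrPdist_le => e e0.
have be0 : 0 < b - a + 1 by rewrite ltr_wpDl// subr_ge0.
have := near_uniform_itv a b p cf (divr_gt0 e0 be0).
apply: filterS => q Hq.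
have int r := continuous_itv_integrable a b (@slice_continuous _ _ f r cf).
have cB : continuous (fun y => f (p, y) - f (q, y)).
  by move=> y; apply: cvgB; exact: slice_continuous.
rewrite -RintegralB//; try exact: int.
apply: (le_trans (le_normr_Rintegral _ _)) => //.
  exact: (continuous_itv_integrable a b cB).
apply: (@le_trans _ _ (\int[mu]_(y in `[a, b]) (e / (b - a + 1)))).
  apply: le_Rintegral => //.
  - apply: (@continuous_itv_integrable (fun y => `|f (p, y) - f (q, y)|)) => y.
    by apply: cvg_norm; exact: cB.
  - by apply: (@continuous_itv_integrable (fun=> _)) => y; exact: cvg_cst.
  - by move=> y /Hq /ltW.
rewrite Rintegral_cst//= lebesgue_measure_itv/= lte_fin.
case: ifPn => _ /=; last by rewrite mulr0 ltW.
rewrite -mulrA ler_piMr ?ltW// mulrC ltr_pdivrMr// mul1r.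
lra.
Qed.

(** Near [s] the partial derivative is dominated by [`|d (s, y)| + 1]. *)
Lemma is_derive_param_integral (f : R -> R -> R) (d : R * R -> R) (a b : R) :
  continuous d -> (forall s, continuous (f s)) ->
  (forall s y : R, is_derive s (1 : R) (f ^~ y) (d (s, y))) ->
  forall s : R, is_derive s (1 : R) (fun s => \int[mu]_(y in `[a, b]) f s y)
    (\int[mu]_(y in `[a, b]) d (s, y)).
Proof.
move=> cd cf df s.
have [e /= e0 He] := near_uniform_itv a b s cd (@ltr01 R).
pose G y := `|d (s, y)| + 1.
have cG : continuous G.
  by move=> y; apply: cvgD; [apply: cvg_norm; exact: slice_continuous|exact: cvg_cst].
have d1E x y : partial1of2 f x y = d (x, y).
  by rewrite partial1of2E; apply: derive_val.
have Is : `]s - e, s + e[%classic s by rewrite /= in_itv/=; apply/andP; split; lra.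
have intf x : `]s - e, s + e[%classic x -> mu.-integrable `[a, b] (EFin \o f x).
  by move=> _; exact: continuous_itv_integrable.
have derf x y : `]s - e, s + e[%classic x -> `[a, b]%classic y -> derivable (f ^~ y) x 1.
  by [].
have G0 y : 0 <= G y by rewrite addr_ge0.
have intG := continuous_itv_integrable a b cG.
have Gub x y : `]s - e, s + e[%classic x -> `[a, b]%classic y -> `|partial1of2 f x y| <= G y.
  rewrite /= in_itv/= => /andP[x1 x2] aby; rewrite d1E /G.
  have /He/(_ _ aby) : ball s e x by rewrite /ball/= ltr_distlC x1.
  rewrite distrC => /ltW H; rewrite -lerBlDl; apply: le_trans H.
  exact: lerB_dist.
have mI : measurable (`[a, b]%classic : set R) by [].
have H1 := @derivable_under_integral _ _ _ mu f _ mI s _ _ Is intf derf G G0 intG Gub.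
have H2 := @differentiation_under_integral _ _ _ mu f _ mI s _ _ Is intf derf G G0 intG Gub.
apply: DeriveDef; first exact: H1.
rewrite -derive1E H2; apply: eq_Rintegral => y _; exact: d1E.
Qed.

Lemma FTC2_line (F f : R -> R) (a b : R) : a < b -> continuous f ->
  (forall x : R, is_derive x (1 : R) F (f x)) -> \int[mu]_(x in `[a, b]) f x = F b - F a.
Proof.
move=> ab cf dF.
have cF : continuous F.
  by move=> x; apply: differentiable_continuous; apply/derivable1_diffP.
rewrite /Rintegral (@continuous_FTC2 _ f F)//.
- exact: continuous_subspaceT.
- split=> //; [apply: cvg_at_right_filter; exact: cF|apply: cvg_at_left_filter; exact: cF].
- by move=> x _; rewrite derive1E; apply: derive_val.
Qed.

Lemma is_derive_slice1 (W Z : normedModType R) (g : R * W -> Z) (s : R) (y : W) :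
  smooth g -> is_derive s (1 : R) (fun s => g (s, y)) ('D_(1, 0) g (s, y)).
Proof.
move=> sg; have si : smooth (fun s : R => (s, y)).
  by apply: smooth_pair; [exact: smooth_id|exact: smooth_cst].
have dg := smooth_differentiable _ sg; have di := smooth_differentiable _ si.
apply: DeriveDef.
  by apply: diff_derivable; apply: (@differentiable_comp _ _ _ _ (fun s : R => (s, y)) g).
rewrite (@derive_comp _ _ _ _ (fun s : R => (s, y)) g)//.
by rewrite derive_pair// derive_id derive_cst.
Qed.

Lemma is_derive_slice2 (W Z : normedModType R) (g : W * R -> Z) (y : W) (s : R) :
  smooth g -> is_derive s (1 : R) (fun s => g (y, s)) ('D_(0, 1) g (y, s)).
Proof.
move=> sg; have si : smooth (fun s : R => (y, s)).
  by apply: smooth_pair; [exact: smooth_cst|exact: smooth_id].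
have dg := smooth_differentiable _ sg; have di := smooth_differentiable _ si.
apply: DeriveDef.
  by apply: diff_derivable; apply: (@differentiable_comp _ _ _ _ (fun s : R => (y, s)) g).
rewrite (@derive_comp _ _ _ _ (fun s : R => (y, s)) g)//.
by rewrite derive_pair// derive_id derive_cst.
Qed.

(** The inner integral of the [y]-derivative vanishes by periodicity.  What is
    left is the [x]-derivative of the inner integral of [Q], which has equal
    values at both ends. *)
Lemma stokes_rectangle (P Q : R * R -> R) (a b : R) :
  0 < a -> 0 < b -> smooth P -> smooth Q ->
  (forall x, P (x, b) = P (x, 0)) -> (forall y, Q (a, y) = Q (0, y)) ->
  \int[mu]_(x in `[0, a]) \int[mu]_(y in `[0, b])
    ('D_(1, 0) Q (x, y) - 'D_(0, 1) P (x, y)) = 0.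
Proof.
move=> a0 b0 sP sQ Pb Qa.
have cQ := smooth_continuous (@smooth_derive _ _ _ Q (1, 0) sQ).
have cP := smooth_continuous (@smooth_derive _ _ _ P (0, 1) sP).
have inner x : \int[mu]_(y in `[0, b]) ('D_(1, 0) Q (x, y) - 'D_(0, 1) P (x, y)) =
    \int[mu]_(y in `[0, b]) 'D_(1, 0) Q (x, y).
  rewrite RintegralB//; [|exact: (continuous_itv_integrable 0 b (@slice_continuous _ _ _ x cQ))
                         |exact: (continuous_itv_integrable 0 b (@slice_continuous _ _ _ x cP))].
  have -> : \int[mu]_(y in `[0, b]) 'D_(0, 1) P (x, y) = P (x, b) - P (x, 0).
    apply: (@FTC2_line (fun y => P (x, y))) => //; first exact: (@slice_continuous _ _ _ x cP).
    by move=> y; exact: is_derive_slice2.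
  by rewrite Pb subrr subr0.
under eq_Rintegral do rewrite inner.
transitivity (\int[mu]_(y in `[0, b]) Q (a, y) - \int[mu]_(y in `[0, b]) Q (0, y)).
  2: by under eq_Rintegral do rewrite Qa; rewrite subrr.
apply: (@FTC2_line (fun x => \int[mu]_(y in `[0, b]) Q (x, y))) => //.
- by apply: (@param_integral_continuous _ ('D_(1, 0) Q)) => //; exact: ltW.
- apply: (@is_derive_param_integral (fun x y => Q (x, y)) ('D_(1, 0) Q)) => //.
  + by move=> x; apply: (@slice_continuous _ _ Q); exact: smooth_continuous.
  + by move=> x y; exact: is_derive_slice1.
Qed.

(** Differentiation under both integral signs. *)
Lemma iterated_integral_constant (k : R * (R * R) -> R) (a b : R) :
  0 < a -> 0 < b -> smooth k ->
  (forall s, \int[mu]_(x in `[0, a]) \int[mu]_(y in `[0, b])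
     'D_(1, 0) k (s, (x, y)) = 0) ->
  forall s t, \int[mu]_(x in `[0, a]) \int[mu]_(y in `[0, b]) k (s, (x, y)) =
    \int[mu]_(x in `[0, a]) \int[mu]_(y in `[0, b]) k (t, (x, y)).
Proof.
move=> a0 b0 sk k0 s t.
(* Regroups the variables so that [s] and [x] together are the parameter. *)
pose assoc (z : (R * R) * R) : R * (R * R) := (z.1.1, (z.1.2, z.2)).
have sassoc : smooth assoc.
  have s1 := @smooth_fst R (R * R)%type R.
  apply: smooth_pair; first exact: smooth_comp (findim_prod (findim_scalar) (findim_scalar)) s1 (@smooth_fst _ _ _).
  by apply: smooth_pair; [exact: smooth_comp (findim_prod (findim_scalar) (findim_scalar)) s1 (@smooth_snd _ _ _)|exact: smooth_snd].
have fd : findim (R * (R * R))%type.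
  by do 2?[apply: findim_prod; first exact: findim_scalar]; exact: findim_scalar.
have sk' : smooth (k \o assoc) by exact: smooth_comp.
have sdk' : smooth ('D_(1, 0) k \o assoc) by apply: smooth_comp => //; exact: smooth_derive.
have cC := param_integral_continuous (ltW b0) (smooth_continuous sk').
have cdC := param_integral_continuous (ltW b0) (smooth_continuous sdk').
pose C s x := \int[mu]_(y in `[0, b]) k (s, (x, y)).
pose dC (z : R * R) := \int[mu]_(y in `[0, b]) 'D_(1, 0) k (z.1, (z.2, y)).
have dCE s' x : is_derive s' (1 : R) (C ^~ x) (dC (s', x)).
  apply: (@is_derive_param_integral (fun s y => k (s, (x, y)))
    (fun z => 'D_(1, 0) k (z.1, (x, z.2)))).
  - move=> z; apply: (@continuous_comp _ _ _ (fun z : R * R => ((z.1, x), z.2)) ('D_(1, 0) k \o assoc)).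
      apply: smooth_continuous; apply: smooth_pair; last exact: smooth_snd.
      by apply: smooth_pair; [exact: smooth_fst|exact: smooth_cst].
    exact: smooth_continuous.
  - by move=> s''; apply: (@slice_continuous _ _ (k \o assoc) (s'', x)); exact: smooth_continuous.
  - by move=> s'' y; exact: is_derive_slice1.
have dA s' : is_derive s' (1 : R) (fun s => \int[mu]_(x in `[0, a]) C s x) 0.
  rewrite -[X in is_derive _ _ _ X](k0 s').
  apply: (@is_derive_param_integral C dC 0 a cdC _ dCE s') => s''.
  exact: (@slice_continuous _ _ (fun z : R * R => C z.1 z.2)).
exact: (@is_derive_0_is_cst _ (fun s => \int[mu]_(x in `[0, a]) C s x) s t dA).
Qed.

(** Two uses of the mean value theorem, first in [x] and then in [y]. *)
Lemma mixed_difference (g : R * R -> R) (x y h : R) : smooth g -> 0 < h ->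
  exists z : R * R, [/\ `|x - z.1| <= h, `|y - z.2| <= h &
   g (x + h, y + h) - g (x + h, y) - (g (x, y + h) - g (x, y)) =
     'D_(0, 1) ('D_(1, 0) g) z * h * h].
Proof.
move=> sg h0.
have sDg := @smooth_derive _ _ _ g (1, 0) sg.
have within (f df : R -> R) (a b : R) : (forall s, is_derive s (1 : R) f (df s)) ->
    {within `[a, b], continuous f}.
  move=> dfd; apply: continuous_subspaceT => s.
  by apply: differentiable_continuous; apply/derivable1_diffP.
have da s : is_derive s (1 : R) (fun s => g (s, y + h) - g (s, y))
    ('D_(1, 0) g (s, y + h) - 'D_(1, 0) g (s, y)).
  by apply: is_deriveB; exact: is_derive_slice1.
have db c t : is_derive t (1 : R) (fun t => 'D_(1, 0) g (c, t))
    ('D_(0, 1) ('D_(1, 0) g) (c, t)).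
  exact: is_derive_slice2.
have xh : x < x + h by rewrite ltrDl.
have yh : y < y + h by rewrite ltrDl.
have [c + ->] := MVT xh (fun s _ => da s) (within _ _ _ _ da).
rewrite in_itv/= => /andP[c1 c2].
have [d + ->] := MVT yh (fun t _ => db c t) (within _ _ _ _ (db c)).
rewrite in_itv/= => /andP[d1 d2].
exists (c, d); split => /=.
- by rewrite ler0_norm; lra.
- by rewrite ler0_norm; lra.
- by congr (_ * _ * _); rewrite addrAC subrr add0r.
Qed.

(** Exchanging the coordinates turns one mixed derivative into the other, so
    that [mixed_difference] serves for both. *)
Lemma derive_swap (g : R * R -> R) (v z : R * R) : smooth g ->
  'D_v (fun z => g (z.2, z.1)) z = 'D_(v.2, v.1) g (z.2, z.1).
Proof.
move=> sg; have sw : smooth (fun z : R * R => (z.2, z.1)).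
  by apply: smooth_pair; [exact: smooth_snd|exact: smooth_fst].
rewrite (@derive_comp _ _ _ _ (fun z : R * R => (z.2, z.1)) g); last 2 first.
  exact: smooth_differentiable.
  exact: smooth_differentiable.
have E2 : 'D_v (fun z : R * R => z.2) z = v.2.
  by apply: (@derive_linear _ _ _ (snd : {linear _ -> _})) => y; exact: cvg_snd.
have E1 : 'D_v (fun z : R * R => z.1) z = v.1.
  by apply: (@derive_linear _ _ _ (fst : {linear _ -> _})) => y; exact: cvg_fst.
rewrite derive_pair ?E1 ?E2//; apply: smooth_differentiable.
- exact: smooth_snd.
- exact: smooth_fst.
Qed.

Lemma eq_common_values (A B : R * R -> R) (x y : R) :
  continuous A -> continuous B ->
  (forall h, 0 < h -> exists z1 z2 : R * R,
    [/\ `|x - z1.1| <= h, `|y - z1.2| <= h, `|x - z2.1| <= h, `|y - z2.2| <= h &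
     A z1 = B z2]) ->
  A (x, y) = B (x, y).
Proof.
move=> cA cB common; apply/eqP; rewrite -subr_eq0 -normr_le0; apply/ler_addgt0Pl => e e0.
rewrite addr0; have e20 : 0 < e / 2 by rewrite divr_gt0.
have /cvgrPdist_lt/(_ _ e20) H1 := cA (x, y).
have /cvgrPdist_lt/(_ _ e20) H2 := cB (x, y).
have /nbhs_ballP[r /= r0 Hr] : \forall z \near (x, y),
    `|A (x, y) - A z| < e / 2 /\ `|B (x, y) - B z| < e / 2 by exact: filterI.
have r20 : 0 < r / 2 by rewrite divr_gt0.
have [z1 [z2 [a1 a2 a3 a4 E]]] := common _ r20.
have lt2 (t : R) : t <= r / 2 -> t < r by lra.
have [/= + _] := Hr z1 (conj (lt2 _ a1) (lt2 _ a2)).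
have [/= _ +] := Hr z2 (conj (lt2 _ a3) (lt2 _ a4)).
rewrite -E !ltr_norml => /andP[? ?] /andP[? ?].
by rewrite ler_norml; apply/andP; split; lra.
Qed.

(** Both mixed derivatives take the value of the same second difference
    quotient at points arbitrarily close to [z]. *)
Lemma schwarz (g : R * R -> R) (z : R * R) : smooth g ->
  'D_(0, 1) ('D_(1, 0) g) z = 'D_(1, 0) ('D_(0, 1) g) z.
Proof.
move=> sg; case: z => x y.
have s1 := @smooth_derive _ (R * R)%type _ g (1, 0) sg.
have s2 := @smooth_derive _ (R * R)%type _ g (0, 1) sg.
have s12 := @smooth_derive _ (R * R)%type _ _ (0, 1) s1.
have s21 := @smooth_derive _ (R * R)%type _ _ (1, 0) s2.
have sw : smooth (fun z : R * R => (z.2, z.1)).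
  by apply: smooth_pair; [exact: smooth_snd|exact: smooth_fst].
have sgs : smooth (fun z => g (z.2, z.1)).
  by apply: (smooth_comp _ sw sg); apply: findim_prod; exact: findim_scalar.
apply: (@eq_common_values ('D_(0, 1) ('D_(1, 0) g)) ('D_(1, 0) ('D_(0, 1) g)) x y
  (smooth_continuous s12) (smooth_continuous s21)) => h h0.
have [z1 [x1 y1 E1]] := mixed_difference x y sg h0.
have [[b a] [/= y2 x2]] := mixed_difference y x sgs h0.
have -> : 'D_(1, 0) (fun z : R * R => g (z.2, z.1)) = fun z => 'D_(0, 1) g (z.2, z.1).
  by apply/funext => w; rewrite (@derive_swap g).
rewrite (@derive_swap ('D_(0, 1) g) (0, 1) (b, a) s2) => E2.
exists z1, (a, b); move: E1 E2 => /=.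
move: ('D_(0, 1) ('D_(1, 0) g) z1) ('D_(1, 0) ('D_(0, 1) g) (a, b)) => A B E1 E2.
split=> //; have hh : h * h != 0 by rewrite mulf_neq0 ?gt_eqF.
by apply: (mulIf hh); rewrite !mulrA -E1 -E2; ring.
Qed.

End ParamIntegral.

(** * Vectors tangent to a surface in space *)

Section VectorAlgebra.
Context {R : realType}.
Notation E := 'rV[R]_3.
Implicit Types a b c n v x y z : E.

(** On vectors orthogonal to a unit normal [n], [triple n] is the area form. *)
Definition triple x y z : R := dot (cross x y) z.

Lemma crossE x y : (cross x y 0 0 = x 0 1 * y 0 2 - x 0 2 * y 0 1) *
  (cross x y 0 1 = x 0 2 * y 0 0 - x 0 0 * y 0 2) *
  (cross x y 0 2 = x 0 0 * y 0 1 - x 0 1 * y 0 0).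
Proof. by rewrite /cross !vec3E. Qed.

Lemma addE x y (i : 'I_3) : (x + y) 0 i = x 0 i + y 0 i. Proof. by rewrite !mxE. Qed.
Lemma oppE x (i : 'I_3) : (- x) 0 i = - x 0 i. Proof. by rewrite !mxE. Qed.
Lemma scaleE (k : R) x (i : 'I_3) : (k *: x) 0 i = k * x 0 i. Proof. by rewrite !mxE. Qed.

Definition vecE := (@dotE R, crossE, addE, oppE, scaleE, @vec3E R).

Lemma dotC x y : dot x y = dot y x.
Proof. by rewrite !dotE; ring. Qed.

Lemma cross_cross x y z : cross (cross x y) z = dot x z *: y - dot y z *: x.
Proof. by apply: vecP; rewrite !vecE; ring. Qed.

Lemma dot_decomposition n c : dot n n *: c = dot c n *: n + cross n (cross c n).
Proof. by apply: vecP; rewrite !vecE; ring. Qed.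

(** The part of [cross a b] orthogonal to [n] is determined by its cross product
    with [n], which vanishes by the double cross product formula. *)
Lemma cross_tangent n a b : dot n n = 1 -> dot a n = 0 -> dot b n = 0 ->
  cross a b = triple n a b *: n.
Proof.
move=> n1 an bn; rewrite -[LHS]scale1r -n1 dot_decomposition cross_cross an bn.
rewrite !scale0r subrr; set z := cross n 0.
have -> : z = 0 by apply: vecP; rewrite /z !vecE !mxE; ring.
by rewrite addr0 /triple; congr (_ *: _); rewrite !vecE; ring.
Qed.

Lemma triple_tangent0 n a b c : dot n n = 1 -> dot a n = 0 -> dot b n = 0 ->
  dot c n = 0 -> triple a b c = 0.
Proof.
move=> n1 an bn cn; rewrite /triple (cross_tangent n1 an bn).
have -> : dot (triple n a b *: n) c = triple n a b * dot c n by rewrite !vecE; ring.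
by rewrite cn mulr0.
Qed.

(** Cramer's rule in the basis [n], [a], [b], without dividing by the
    determinant: the poles, where it vanishes, are not exceptional. *)
Lemma tangent_cramer n a b v : dot n n = 1 -> dot a n = 0 -> dot b n = 0 ->
  dot v n = 0 -> triple n a b *: v = triple n v b *: a - triple n v a *: b.
Proof.
move=> n1 an bn vn.
have : triple n a b *: v = triple v a b *: n + (triple n v b *: a - triple n v a *: b).
  by rewrite /triple; apply: vecP; rewrite !vecE; ring.
by rewrite (triple_tangent0 n1 vn an bn) scale0r add0r.
Qed.

Lemma linear3E (W : lmodType R) (L : {linear E -> W}) x :
  L x = x 0 0 *: L (basis3 0) + x 0 1 *: L (basis3 1) + x 0 2 *: L (basis3 2).
Proof. by rewrite -!linearZ -!linearD; congr (L _); apply: vecP; rewrite /basis3 !mxE /=; ring. Qed.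

(** The derivative of the determinant at the identity is the trace. *)
Lemma triple_trace (L : {linear E -> E}) x y z :
  triple (L x) y z + triple x (L y) z + triple x y (L z) =
  (\sum_i L (basis3 i) 0 i) * triple x y z.
Proof. by rewrite sum3 (linear3E L x) (linear3E L y) (linear3E L z) /triple !vecE; ring. Qed.

(** With the position [x] and the rotation field [(- x1, x0, 0)] tangent, the
    Coriolis term paired with that field is the derivative of
    [(x0 ^+ 2 + x1 ^+ 2) / 2] along [v]: on a surface of revolution [chi] times
    the differential of [xi] has this function as a primitive, up to sign. *)
Lemma coriolis_identity n v x : dot n n = 1 -> dot v n = 0 ->
  dot n (vec3 (- x 0 1) (x 0 0) 0) = 0 ->
  dot (e3 : E) n * dot (cross n v) (vec3 (- x 0 1) (x 0 0) 0) =
  dot v (vec3 (x 0 0) (x 0 1) 0).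
Proof.
move=> n1 vn nX; apply/eqP; rewrite eq_sym -subr_eq0; apply/eqP.
transitivity ((1 - dot n n) * dot v (vec3 (x 0 0) (x 0 1) 0) +
  dot v n * (n 0 0 * x 0 0 + n 0 1 * x 0 1) +
  dot n (vec3 (- x 0 1) (x 0 0) 0) * (v 0 0 * n 0 1 - v 0 1 * n 0 0)).
  by rewrite /e3 !vecE; ring.
by rewrite n1 vn nX subrr !mul0r !addr0.
Qed.

Lemma dotZl (k : R) x y : dot (k *: x) y = k * dot x y.
Proof. by rewrite !vecE; ring. Qed.

Lemma dot0l x : dot 0 x = 0.
Proof. by rewrite dotE !mxE; ring. Qed.

Lemma dot0r x : dot x 0 = 0.
Proof. by rewrite dotC dot0l. Qed.

Lemma dot_eq0 x : dot x x = 0 -> x = 0.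
Proof.
move/eqP; rewrite dotE -!expr2 paddr_eq0 ?addr_ge0 ?sqr_ge0//.
rewrite paddr_eq0 ?sqr_ge0// !sqrf_eq0 => /andP[/andP[/eqP x0 /eqP x1] /eqP x2].
by apply: vecP; rewrite mxE.
Qed.

(** If [a] and [b] are parallel so are their images, and a vector parallel to a
    unit vector and orthogonal to it is zero. *)
Lemma linear_image_parallel (L : {linear E -> E}) a b : cross a b = 0 ->
  dot (L a) (L a) = 1 -> dot (L b) (L a) = 0 -> L b = 0.
Proof.
move=> ab0 La1 Lba.
have E1 : dot a a *: b = dot a b *: a.
  (* The double cross product formula. *)
  have -> : dot a a *: b = dot a b *: a + cross (cross a b) a.
    by rewrite cross_cross (dotC b) addrC subrK.
  by rewrite ab0; apply: vecP; rewrite !vecE !mxE; ring.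
have E2 : dot a a *: L b = dot a b *: L a by rewrite -!linearZ E1.
have := congr1 (dot ^~ (L a)) E2; rewrite !dotZl La1 Lba mulr0 mulr1 => abE.
move: E2; rewrite -abE scale0r => /eqP; rewrite scaler_eq0 => /orP[|/eqP//].
move=> /eqP/dot_eq0 a0; move: La1; rewrite a0 linear0 dot0l => /eqP.
by rewrite eq_sym oner_eq0.
Qed.

End VectorAlgebra.

(** * Polar coordinates and rotations *)

Section Sphere.
Context {R : realType}.
Notation E := 'rV[R]_3.
Notation d1 := ((1, 0) : R * R).
Notation d2 := ((0, 1) : R * R).

Lemma smooth_sin_fst : smooth (fun z : R * R => sin z.1).
Proof. exact: (smooth_comp findim_scalar (@smooth_fst _ _ _) (smooth_trig.1)). Qed.
Lemma smooth_cos_fst : smooth (fun z : R * R => cos z.1).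
Proof. exact: (smooth_comp findim_scalar (@smooth_fst _ _ _) (smooth_trig.2)). Qed.
Lemma smooth_sin_snd : smooth (fun z : R * R => sin z.2).
Proof. exact: (smooth_comp findim_scalar (@smooth_snd _ _ _) (smooth_trig.1)). Qed.
Lemma smooth_cos_snd : smooth (fun z : R * R => cos z.2).
Proof. exact: (smooth_comp findim_scalar (@smooth_snd _ _ _) (smooth_trig.2)). Qed.

Definition sph (z : R * R) : E := sphere_param z.1 z.2.

Lemma sph_smooth : smooth sph.
Proof.
apply: smooth_vec3; [apply: smooth_mul|apply: smooth_mul|exact: smooth_cos_fst].
- exact: smooth_sin_fst.
- exact: smooth_cos_snd.
- exact: smooth_sin_fst.
- exact: smooth_sin_snd.
Qed.

Lemma sph_unit z : unit_sphere (sph z).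
Proof.
rewrite /unit_sphere/= /enorm; suff -> : dot (sph z) (sph z) = 1 by rewrite sqrtr1.
rewrite /sph /sphere_param !vecE.
transitivity (sin z.1 ^+ 2 * (cos z.2 ^+ 2 + sin z.2 ^+ 2) + cos z.1 ^+ 2); first by ring.
by rewrite cos2Dsin2 mulr1 addrC cos2Dsin2.
Qed.

Lemma derive_sph1 z : 'D_d1 sph z =
  vec3 (cos z.1 * cos z.2) (cos z.1 * sin z.2) (- sin z.1).
Proof.
case: z => x y /=; have <- := @derive_val _ _ _ _ _ _ _ (is_derive_slice1 x y sph_smooth).
have s1 : smooth (fun s : R => sph (s, y)).
  apply: (smooth_comp _ _ sph_smooth); first exact: findim_prod findim_scalar findim_scalar.
  by apply: smooth_pair; [exact: smooth_id|exact: smooth_cst].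
by apply: vecP; rewrite -(derive_coord _ _ _ s1) vec3E /sph /sphere_param /=;
  under eq_fun do rewrite vec3E; rewrite derive_val /GRing.scale /= ?mulr0 ?add0r ?addr0 ?mulr1// mulrC.
Qed.

Lemma derive_sph2 z : 'D_d2 sph z =
  vec3 (- (sin z.1 * sin z.2)) (sin z.1 * cos z.2) 0.
Proof.
case: z => x y /=; have <- := @derive_val _ _ _ _ _ _ _ (is_derive_slice2 x y sph_smooth).
have s1 : smooth (fun s : R => sph (x, s)).
  apply: (smooth_comp _ _ sph_smooth); first exact: findim_prod findim_scalar findim_scalar.
  by apply: smooth_pair; [exact: smooth_cst|exact: smooth_id].
by apply: vecP; rewrite -(derive_coord _ _ _ s1) vec3E /sph /sphere_param /=;
  under eq_fun do rewrite vec3E; rewrite derive_val /GRing.scale /= ?mulr0 ?add0r ?addr0 ?mulr1 ?mulrN// mulrC.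
Qed.

Lemma smooth_rot3 (x : E) : smooth (fun theta => rot3 theta x).
Proof.
have [ss sc] := @smooth_trig R.
apply: smooth_vec3; last exact: smooth_cst.
- by apply: smooth_sub; apply: smooth_mul => //; exact: smooth_cst.
- by apply: smooth_add; apply: smooth_mul => //; exact: smooth_cst.
Qed.

Lemma X3E (x : E) : X3 x = vec3 (- x 0 1) (x 0 0) 0.
Proof.
rewrite /X3 derive1E; apply: vecP; rewrite -(derive_coord _ _ _ (smooth_rot3 x)) vec3E /rot3 /=;
  under eq_fun do rewrite vec3E;
  rewrite derive_val /GRing.scale /= ?sin0 ?cos0; ring.
Qed.

Lemma smooth_X3 (V : normedModType R) (f : V -> E) : smooth f -> smooth (fun z => X3 (f z)).
Proof.
move=> sf; under eq_fun do rewrite X3E.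
by apply: smooth_vec3; [apply: smooth_opp| |exact: smooth_cst]; exact: smooth_coord.
Qed.

Lemma derive_X3 (V : normedModType R) (f : V -> E) z v : smooth f ->
  'D_v (fun z => X3 (f z)) z = X3 ('D_v f z).
Proof.
move=> sf; apply: vecP; rewrite -(derive_coord _ _ _ (smooth_X3 sf));
  under eq_fun do rewrite X3E vec3E; rewrite X3E vec3E -?(derive_coord _ _ _ sf)//.
- rewrite deriveN//; apply: diff_derivable; apply: smooth_differentiable.
  exact: smooth_coord.
- exact: derive_cst.
Qed.

End Sphere.

(** * The surface in polar coordinates *)

Section Surface.
Context {R : realType}.
Notation E := 'rV[R]_3.
Notation d1 := ((1, 0) : R * R).
Notation d2 := ((0, 1) : R * R).
Variables (M : set E) (phi nu : E -> E).
Hypotheses (M_sphere : diffeomorphism unit_sphere M phi)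
  (nu_normal : unit_outward_normal M nu) (M_rot : rotation_invariant M).

Let fd2 : findim (R * R)%type := findim_prod findim_scalar findim_scalar.

Definition param (z : R * R) : E := phi (sph z).
Local Notation psi := param.

Lemma param_smooth : smooth psi.
Proof.
have [sphi _] := M_sphere.
exact: (smooth_on_comp (@findim_rV _ _) sph_smooth sph_unit sphi).
Qed.

Lemma param_in z : M (psi z).
Proof. by have [_ [+ _]] := M_sphere; apply; exact: sph_unit. Qed.

(** The velocity of the image of a straight line in the parameter plane. *)
Lemma param_tangent z v : tangent M (psi z) ('D_v psi z).
Proof.
have sl : smooth (fun s : R => s *: v + z).
  by apply: smooth_add; [apply: smooth_scale; [exact: smooth_id|exact: smooth_cst]|exact: smooth_cst].
exists (fun s => psi (s *: v + z)), setT; split=> //.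
- exact: openT.
- exact: (smooth_comp fd2 sl param_smooth).
- by move=> s _; exact: param_in.
- split; first by rewrite scale0r add0r.
  by rewrite /derive1 /derive; under eq_fun do rewrite addr0 scale0r add0r.
Qed.

Lemma X3_tangent x : M x -> tangent M x (X3 x).
Proof.
move=> Mx; exists (fun theta => rot3 theta x), setT; split=> //.
- exact: openT.
- exact: smooth_rot3.
- by move=> s _; exact: M_rot.
- split=> //; apply: vecP; rewrite /rot3 vec3E ?cos0 ?sin0; ring.
Qed.

Lemma normal_unit x : M x -> dot (nu x) (nu x) = 1.
Proof.
move=> Mx; have [_ /(_ _ Mx)[+ _ _]] := nu_normal; rewrite /enorm => n1.
have n0 : 0 <= dot (nu x) (nu x) by rewrite dotE !addr_ge0// -expr2 sqr_ge0.
by rewrite -[LHS](sqr_sqrtr n0) n1 expr1n.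
Qed.

Lemma normal_tangent x v : M x -> tangent M x v -> dot v (nu x) = 0.
Proof. by move=> Mx tv; have [_ /(_ _ Mx)[_ + _]] := nu_normal; rewrite dotC; apply. Qed.

(** The signed area density of the parametrization. *)
Definition jac z := triple (nu (psi z)) ('D_d1 psi z) ('D_d2 psi z).

Lemma cross_param z : cross ('D_d1 psi z) ('D_d2 psi z) = jac z *: nu (psi z).
Proof.
have Mz := param_in z; apply: cross_tangent; first exact: normal_unit.
- by apply: normal_tangent => //; exact: param_tangent.
- by apply: normal_tangent => //; exact: param_tangent.
Qed.

Lemma surface_integralE (f : E -> R) : surface_integral phi f =
  \int[lebesgue_measure]_(x in `[0, pi]) \int[lebesgue_measure]_(y in `[0, 2 * pi])
    (f (psi (x, y)) * `|jac (x, y)|).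
Proof.
rewrite /surface_integral; apply: eq_Rintegral => x _; apply: eq_Rintegral => y _.
congr (_ * _); rewrite !derive1E.
have -> : 'D_1 (fun t => phi (sphere_param t y)) x = 'D_d1 psi (x, y).
  exact: (@derive_val _ _ _ _ _ _ _ (is_derive_slice1 x y param_smooth)).
have -> : 'D_1 (fun t => phi (sphere_param x t)) y = 'D_d2 psi (x, y).
  exact: (@derive_val _ _ _ _ _ _ _ (is_derive_slice2 x y param_smooth)).
rewrite cross_param /enorm.
have -> (k : R) (v : E) : dot (k *: v) (k *: v) = k ^+ 2 * dot v v by rewrite !vecE; ring.
by rewrite normal_unit ?mulr1 ?sqrtr_sqr//; exact: param_in.
Qed.

(** The inverse diffeomorphism maps the two coordinate velocities to those on
    the sphere, which are orthogonal and nonzero away from the poles.  Two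
    parallel vectors cannot have such images. *)
Lemma jac_neq0 z : sin z.1 != 0 -> jac z != 0.
Proof.
move=> sz; apply/eqP => j0.
have [_ [_ [g [sg _ gphi _]]]] := M_sphere.
have gpsi : g \o psi = sph.
  by apply/funext => w; rewrite /= gphi//; exact: sph_unit.
have [L LE] := tderive_linear (param_in z) sg.
have DL v : 'D_v sph z = L ('D_v psi z).
  rewrite -LE -gpsi; apply: tderive_comp => //; last exact: param_in.
  exact: smooth_differentiable _ param_smooth.
have s1 : dot ('D_d1 sph z) ('D_d1 sph z) = 1.
  rewrite derive_sph1 !vecE.
  transitivity (cos z.1 ^+ 2 * (cos z.2 ^+ 2 + sin z.2 ^+ 2) + sin z.1 ^+ 2); first by ring.
  by rewrite !cos2Dsin2 mulr1 cos2Dsin2.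
have s2 : dot ('D_d2 sph z) ('D_d2 sph z) = sin z.1 ^+ 2.
  rewrite derive_sph2 !vecE.
  transitivity (sin z.1 ^+ 2 * (cos z.2 ^+ 2 + sin z.2 ^+ 2)); first by ring.
  by rewrite cos2Dsin2 mulr1.
have s12 : dot ('D_d2 sph z) ('D_d1 sph z) = 0.
  by rewrite derive_sph1 derive_sph2 !vecE; ring.
have := cross_param z; rewrite j0 scale0r => ab0.
rewrite DL in s1; rewrite !DL in s12.
have L0 := linear_image_parallel ab0 s1 s12.
move: s2; rewrite DL L0 dot0l => /esym/eqP.
by rewrite sqrf_eq0 (negPf sz).
Qed.

Lemma normal_smooth : smooth (fun z => nu (psi z)).
Proof.
have [snu _] := nu_normal.
exact: (smooth_on_comp (@findim_rV _ _) param_smooth param_in snu).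
Qed.

Lemma triple_smooth (V : normedModType R) (f g h : V -> E) :
  smooth f -> smooth g -> smooth h -> smooth (fun z => triple (f z) (g z) (h z)).
Proof. by move=> sf sg sh; apply: smooth_dot => //; exact: smooth_cross. Qed.

Lemma jac_smooth : smooth jac.
Proof.
apply: triple_smooth; first exact: normal_smooth.
- exact: (@smooth_derive _ _ _ psi d1 param_smooth).
- exact: (@smooth_derive _ _ _ psi d2 param_smooth).
Qed.

(** The parallels shrink to a point at the poles. *)
Lemma derive_param2_pole z : sin z.1 = 0 -> 'D_d2 psi z = 0.
Proof.
move=> s0; have [sphi _] := M_sphere.
have [L LE] := tderive_linear (sph_unit z) sphi.
rewrite (@tderive_comp _ _ _ _ unit_sphere phi sph) => //.
- rewrite LE derive_sph2 s0 (_ : vec3 _ _ _ = 0) ?linear0//.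
  by apply: vecP; rewrite vec3E mxE ?mul0r ?oppr0.
- exact: smooth_differentiable _ sph_smooth.
- exact: sph_unit.
Qed.

Lemma midpoint_segment (p x s : R) : 0 < x < p -> 0 <= s <= 1 ->
  0 < p / 2 + s * (x - p / 2) < p.
Proof.
move=> /andP[x0 xp] /andP[s0 s1]; have p0 := lt_trans x0 xp.
have sx : 0 <= s * x by rewrite mulr_ge0// ltW.
have sx' : 0 <= s * (p - x) by rewrite mulr_ge0// ltW// subr_gt0.
have [->|sn1] := eqVneq s 1; first by apply/andP; split; lra.
have sp' : 0 < (1 - s) * p by rewrite mulr_gt0// subr_gt0 lt_neqAle sn1.
by apply/andP; split; lra.
Qed.

Lemma sg_no_zero (x y : R) : x != 0 -> y != 0 ->
  ~ (Num.min x y <= 0 <= Num.max x y) -> `|y| = Num.sg x * y.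
Proof.
case: (ltgtP x 0) => // x0 _; case: (ltgtP y 0) => // y0 _ no.
- by rewrite ltr0_sg// ltr0_norm// mulN1r.
- by exfalso; apply: no; rewrite ge_min le_max (ltW x0) (ltW y0) orbT.
- by exfalso; apply: no; rewrite ge_min le_max (ltW x0) (ltW y0) orbT.
- by rewrite gtr0_sg// gtr0_norm// mul1r.
Qed.

(** Away from the poles [jac] has no zero on a convex set, so by the
    intermediate value theorem it keeps the sign it has at [(pi / 2, 0)]; at
    the poles it is zero.  Thus the area element, an absolute value, can be
    replaced by the smooth function [jac]. *)
Lemma jac_sign : exists eps : R, forall z, 0 <= z.1 <= pi -> `|jac z| = eps * jac z.
Proof.
pose z0 : R * R := (pi / 2, 0).
exists (Num.sg (jac z0)) => z /andP[z1 z2].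
have [s0|s0] := eqVneq (sin z.1) 0.
  rewrite (_ : jac z = 0) ?normr0 ?mulr0//.
  by rewrite /jac derive_param2_pole// /triple dotE !mxE !mulr0 !addr0.
have zpi : 0 < z.1 < pi.
  rewrite !lt_neqAle z1 z2 !andbT; apply/andP; split; apply/eqP => zE; move: s0.
  - by rewrite -zE sin0 eqxx.
  - by rewrite zE sinpi eqxx.
have sl : smooth (fun s : R => z0 + s *: (z - z0)).
  by apply: smooth_add; [exact: smooth_cst|apply: smooth_scale; [exact: smooth_id|exact: smooth_cst]].
pose f s := jac (z0 + s *: (z - z0)).
have sf : smooth f by exact: (smooth_comp fd2 sl jac_smooth).
have f0 : f 0 = jac z0 by rewrite /f scale0r addr0.
have f1 : f 1 = jac z by rewrite /f scale1r addrC subrK.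
(* On the segment from [z0] to [z] the colatitude stays strictly between
   0 and [pi]. *)
have fn0 s : s \in `[0, 1] -> f s != 0.
  rewrite in_itv => s01; apply: jac_neq0; apply: lt0r_neq0; apply: sin_gt0_pi.
  exact: midpoint_segment zpi s01.
have cf : {within `[0, 1], continuous f}.
  by apply: continuous_subspaceT; exact: smooth_continuous.
have j0 : jac z0 != 0 by rewrite -f0; apply: fn0; rewrite in_itv/= lexx ler01.
have j1 : jac z != 0 by rewrite -f1; apply: fn0; rewrite in_itv/= lexx ler01.
have noIVT : ~ (Num.min (f 0) (f 1) <= 0 <= Num.max (f 0) (f 1)).
  by move=> /(IVT ler01 cf)[s /fn0 /eqP].
by rewrite f0 f1 in noIVT; exact: sg_no_zero.
Qed.

End Surface.

(** * Gradient and divergence through the triple product *)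

Section Pointwise.
Context {R : realType}.
Notation E := 'rV[R]_3.

Lemma tproj_is_linear (nu : E -> E) (x : E) : linear (tproj nu x).
Proof. by move=> k a b; rewrite /tproj; apply: vecP; rewrite !vecE; ring. Qed.
HB.instance Definition _ nu x :=
  GRing.isLinear.Build R E E *:%R (tproj nu x) (tproj_is_linear nu x).

Lemma tproj_tangent (nu : E -> E) (x v : E) : dot v (nu x) = 0 -> tproj nu x v = v.
Proof. by rewrite /tproj => ->; rewrite scale0r subr0. Qed.

Lemma dot_tproj (nu : E -> E) (x v y : E) : dot y (nu x) = 0 ->
  dot (tproj nu x v) y = dot v y.
Proof.
move=> yn; have -> : dot (tproj nu x v) y = dot v y - dot v (nu x) * dot y (nu x).
  by rewrite /tproj !vecE; ring.
by rewrite yn mulr0 subr0.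
Qed.

Lemma dot_grad (M : set E) (nu : E -> E) (f : E -> R) x v :
  M x -> smooth_on M f -> dot (grad M nu f x) v = tderive M f x (tproj nu x v).
Proof.
move=> Mx sf; have [L LE] := tderive_linear Mx sf.
have := linear3E (L \o tproj nu x : {linear E -> R}) v; rewrite LE /= => ->.
by rewrite dotE /grad !mxE !LE /GRing.scale /=; ring.
Qed.

(** [triple_trace] for the projected differential, which kills the normal
    direction. *)
Lemma divergenceE (M : set E) (nu : E -> E) (u : E -> E) x a b :
  M x -> smooth_on M u -> dot (nu x) (nu x) = 1 ->
  dot a (nu x) = 0 -> dot b (nu x) = 0 ->
  triple (nu x) (tderive M u x a) b + triple (nu x) a (tderive M u x b) =
  divergence M nu u x * triple (nu x) a b.
Proof.
move=> Mx su n1 an bn; have [L LE] := tderive_linear Mx su.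
have := triple_trace (tproj nu x \o L \o tproj nu x : {linear E -> E}) (nu x) a b.
rewrite /= !(@tproj_tangent _ _ a)// !(@tproj_tangent _ _ b)//.
have -> : tproj nu x (nu x) = 0 by rewrite /tproj n1 scale1r subrr.
rewrite !linear0.
have -> : \sum_(i < 3) tproj nu x (L (tproj nu x (basis3 i))) 0 i = divergence M nu u x.
  by rewrite /divergence /mxtrace; apply: eq_bigr => i _; rewrite [RHS]mxE /covd LE.
move=> <-; rewrite !LE; move: (L a) (L b) => p q.
rewrite /tproj; move: (nu x) => n in n1 an bn *.
have tn k y z : triple n (y - k *: n) z = triple n y z by rewrite /triple !vecE; ring.
have tn' k y z : triple n y (z - k *: n) = triple n y z by rewrite /triple !vecE; ring.
rewrite tn tn'; have -> : triple 0 a b = 0 by rewrite /triple !vecE !mxE; ring.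
by rewrite add0r.
Qed.

End Pointwise.

(** * Iterated integrals and periodicity *)

Section IteratedIntegral.
Context {R : realType}.
Notation mu := (@lebesgue_measure R).

Lemma iterated_integralB (f g : R * R -> R) (a b : R) : 0 < b ->
  continuous f -> continuous g ->
  \int[mu]_(x in `[0, a]) \int[mu]_(y in `[0, b]) (f (x, y) - g (x, y)) =
  \int[mu]_(x in `[0, a]) \int[mu]_(y in `[0, b]) f (x, y) -
  \int[mu]_(x in `[0, a]) \int[mu]_(y in `[0, b]) g (x, y).
Proof.
move=> b0 cf cg; have cF := param_integral_continuous (ltW b0) cf.
have cG := param_integral_continuous (ltW b0) cg.
rewrite -RintegralB//; [|exact: continuous_itv_integrable|exact: continuous_itv_integrable].
apply: eq_Rintegral => x _; rewrite RintegralB//.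
- exact: (continuous_itv_integrable 0 b (@slice_continuous _ _ _ _ x cf)).
- exact: (continuous_itv_integrable 0 b (@slice_continuous _ _ _ _ x cg)).
Qed.

Lemma derive_periodic (W : normedModType R) (f : R * R -> W) (T : R) w x y :
  (forall x y, f (x, y + T) = f (x, y)) -> 'D_w f (x, y + T) = 'D_w f (x, y).
Proof.
move=> fT; have fT' z : f (z + (0, T)) = f z.
  by case: z => p q; rewrite -(fT p q) /= -[(p, q) + _]/(p + 0, q + T) addr0.
have -> : (x, y + T) = (x, y) + (0, T) by rewrite -[RHS]/(x + 0, y + T) addr0.
by rewrite /derive /=; under eq_fun do rewrite addrA !fT'.
Qed.

Lemma derive_triple (V : normedModType R) (f g h : V -> 'rV[R]_3) z w :
  smooth f -> smooth g -> smooth h ->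
  'D_w (fun z => triple (f z) (g z) (h z)) z =
  triple ('D_w f z) (g z) (h z) + triple (f z) ('D_w g z) (h z)
  + triple (f z) (g z) ('D_w h z).
Proof.
move=> sf sg sh; rewrite /triple derive_dot//; last exact: smooth_cross.
rewrite derive_cross//.
move: ('D_w f z) ('D_w g z) ('D_w h z) => p q r.
by rewrite !vecE; ring.
Qed.

End IteratedIntegral.

(** * The two exact forms *)

(** Here [C] is the mixed second derivative of the parametrization; the two
    hypotheses on [n1] and [n2] hold because three tangent vectors are
    linearly dependent. *)
Lemma flux_algebra (R : realType) (n u A B C n1 n2 u1 u2 : 'rV[R]_3) (dv : R) :
  triple n1 u B = 0 -> triple n2 u A = 0 ->
  triple n u1 B + triple n A u2 = dv * triple n A B ->
  (triple n1 u B + triple n u1 B + triple n u C) -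
  (triple n2 u A + triple n u2 A + triple n u C) = dv * triple n A B.
Proof. by move=> -> -> <-; rewrite /triple !vecE; ring. Qed.

Lemma linear_combination (R : realType) (V W : lmodType R) (L : {linear V -> W})
    (j s t : R) (u x y : V) :
  j *: u = s *: x - t *: y -> s *: L x - t *: L y = j *: L u.
Proof.
move=> ju; have ls k z : L (k *: z) = k *: L z by rewrite linearZ.
by rewrite -[RHS]ls ju linearB !ls.
Qed.

Lemma vorticity_algebra (R : realType) (u A B C X u1 u2 : 'rV[R]_3) (x x1 x2 wj j : R) :
  wj = dot u1 B - dot u2 A -> j *: X = x2 *: A - x1 *: B ->
  x * wj - dot u X * j =
  (x1 * dot u B + x * (dot u1 B + dot u C)) - (x2 * dot u A + x * (dot u2 A + dot u C)).
Proof.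
move=> -> jX; have -> : dot u X * j = dot u (j *: X) by rewrite !vecE; ring.
by rewrite jX !vecE; ring.
Qed.

(** The terms with [X3 A] and [X3 B] come from differentiating the rotation
    field.  They cancel because that field is the value of an antisymmetric
    matrix: rotations are isometries.  [x21] and [P] stand for the mixed
    derivative of [xi] and the pressure, whose product cancels too. *)
Lemma euler_algebra (R : realType) (u A B u1 u2 ut y X : 'rV[R]_3)
    (j q p q1 p2 x1 x2 x21 P P1 P2 F Omega : R) :
  j *: u = q *: A - p *: B ->
  j * dot ut X = - dot (q *: u1 - p *: u2) X + Omega * dot (j *: u) y
    - (x2 * P1 - x1 * P2) ->
  q1 - p2 = 0 ->
  j * dot ut X =
  ((- (dot u1 X + dot u (X3 A)) + Omega * dot A y) * q + F * q1 - (P1 * x2 + P * x21)) -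
  ((- (dot u2 X + dot u (X3 B)) + Omega * dot B y) * p + F * p2 - (P2 * x1 + P * x21)).
Proof.
move=> ju -> /eqP; rewrite subr_eq0 => /eqP ->.
(* [X3] is linear and [dot y (X3 y) = 0] for every [y]. *)
have sk : q * dot u (X3 A) - p * dot u (X3 B) = 0.
  have -> : q * dot u (X3 A) - p * dot u (X3 B) = dot u (X3 (j *: u)).
    by rewrite ju !X3E !vecE; ring.
  by rewrite X3E !vecE; ring.
rewrite ju; transitivity (- dot (q *: u1 - p *: u2) X + Omega * dot (q *: A - p *: B) y
    - (x2 * P1 - x1 * P2) - (q * dot u (X3 A) - p * dot u (X3 B))).
  by rewrite sk subr0.
by move: (X3 A) (X3 B) => XA XB; rewrite !vecE; ring.
Qed.

(** The identities are pointwise and hold for a parametrization by any space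
    [V], in two directions along which derivatives commute. *)
Section Flow.
Context {R : realType} {V : normedModType R}.
Notation E := 'rV[R]_3.
Variables (M : set E) (nu : E -> E) (xi : E -> R) (psi : V -> E) (d1 d2 : V).
Hypotheses (nu_normal : unit_outward_normal M nu) (M_rot : rotation_invariant M)
  (xi_smooth : smooth_on M xi)
  (xi_X3 : forall x, M x -> Jrot nu x (grad M nu xi x) = - X3 x)
  (spsi : smooth psi) (psi_in : forall z, M (psi z))
  (psi_tangent : forall z v, tangent M (psi z) ('D_v psi z))
  (commute : forall (f : V -> R) z, smooth f -> 'D_d2 ('D_d1 f) z = 'D_d1 ('D_d2 f) z).

Let N z := nu (psi z).
Let a z := 'D_d1 psi z.
Let b z := 'D_d2 psi z.
Let jac z := triple (N z) (a z) (b z).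

Let sa : smooth a := @smooth_derive _ _ _ psi d1 spsi.
Let sb : smooth b := @smooth_derive _ _ _ psi d2 spsi.

Lemma field_smooth (W : normedModType R) (f : E -> W) : smooth_on M f -> smooth (fun z => f (psi z)).
Proof. by move=> sf; exact: (smooth_on_comp (@findim_rV _ _) spsi psi_in sf). Qed.

Let sN : smooth N := field_smooth nu_normal.1.

Lemma derive_field (W : normedModType R) (f : E -> W) w z : smooth_on M f ->
  'D_w (fun z => f (psi z)) z = tderive M f (psi z) ('D_w psi z).
Proof.
move=> sf; apply: (tderive_comp _ _ psi_in sf).
exact: smooth_differentiable _ spsi.
Qed.

Lemma normalN z : dot (N z) (N z) = 1.
Proof. exact: (normal_unit nu_normal (psi_in z)). Qed.

Lemma tangentN z v : tangent M (psi z) v -> dot v (N z) = 0.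
Proof. exact: (normal_tangent nu_normal (psi_in z)). Qed.

Lemma param_perp w z : dot ('D_w psi z) (N z) = 0.
Proof. exact/tangentN/psi_tangent. Qed.

Lemma X3_perp z : dot (X3 (psi z)) (N z) = 0.
Proof. exact/tangentN/(X3_tangent M_rot)/psi_in. Qed.

Lemma derive_normal_perp w z : dot ('D_w N z) (N z) = 0.
Proof.
(* Differentiate [dot (N z) (N z) = 1]. *)
have := derive_dot z w sN sN.
have -> : (fun z => dot (N z) (N z)) = cst 1 by apply/funext => y; exact: normalN.
rewrite derive_cst (dotC (N z)) => h; lra.
Qed.

(** The hypothesis on [xi] rotated by a quarter turn: the differential of [xi]
    is the contraction of the area form with the rotation field. *)
Lemma grad_xi x v : M x -> dot v (nu x) = 0 ->
  tderive M xi x v = triple (nu x) (X3 x) v.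
Proof.
move=> Mx vn; have n1 := normal_unit nu_normal Mx.
have := dot_grad nu v Mx xi_smooth; rewrite tproj_tangent// => <-.
have Gn : dot (grad M nu xi x) (nu x) = 0.
  rewrite dot_grad// /tproj n1 scale1r subrr.
  by have [L ->] := tderive_linear Mx xi_smooth; rewrite linear0.
have := xi_X3 Mx; rewrite /Jrot => /(congr1 (fun y => triple (nu x) y v)) H.
have -> : triple (nu x) (X3 x) v = - triple (nu x) (- X3 x) v.
  by move: (X3 x) (nu x) => p n; rewrite /triple !vecE; ring.
rewrite -H; move: (grad M nu xi x) (nu x) Gn vn n1 => G n Gn vn n1.
transitivity (dot n n * dot G v - dot G n * dot v n); last by rewrite /triple !vecE; ring.
by rewrite n1 Gn mul1r mul0r subr0.
Qed.

Lemma schwarz_param z : 'D_d2 a z = 'D_d1 b z.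
Proof.
apply/rowP => i.
have e1 := derive_coord i z d2 sa; have e2 := derive_coord i z d1 sb.
have c u : 'D_u (fun x => psi x 0 i) = fun x => 'D_u psi x 0 i.
  by apply/funext => y; exact: derive_coord.
have := commute z (smooth_coord i spsi); rewrite !c => e3.
exact: (etrans (esym e1) (etrans e3 e2)).
Qed.

Let X z := X3 (psi z).
Let Xi z := xi (psi z).
Let sX : smooth X := smooth_X3 spsi.
Let sXi : smooth Xi := field_smooth xi_smooth.

Lemma jac_X3 z : jac z *: X z = 'D_d2 Xi z *: a z - 'D_d1 Xi z *: b z.
Proof.
rewrite (derive_field d1 z xi_smooth) (derive_field d2 z xi_smooth).
rewrite !grad_xi; try by [exact: psi_in|exact: param_perp].
exact: (tangent_cramer (normalN z) (param_perp d1 z) (param_perp d2 z) (X3_perp z)).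
Qed.

Section Field.
Variable v : E -> E.
Hypotheses (v_smooth : smooth_on M v) (v_tangent : forall x, M x -> tangent M x (v x)).
Let U z := v (psi z).
Let sU : smooth U := field_smooth v_smooth.

Lemma field_perp z : dot (U z) (N z) = 0.
Proof. exact/tangentN/v_tangent/psi_in. Qed.

Let q z := triple (N z) (U z) (b z).
Let p z := triple (N z) (U z) (a z).

(** The divergence of [v] is the exterior derivative of the contraction of the
    area form with [v]. *)
Lemma flux_divergence z : 'D_d1 q z - 'D_d2 p z = divergence M nu v (psi z) * jac z.
Proof.
have e1 : 'D_d1 q z = _ := derive_triple z d1 sN sU sb.
have e2 : 'D_d2 p z = _ := derive_triple z d2 sN sU sa.
have f1 : 'D_d1 U z = _ := derive_field d1 z v_smooth.
have f2 : 'D_d2 U z = _ := derive_field d2 z v_smooth.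
rewrite e1 e2 f1 f2 schwarz_param; apply: flux_algebra.
- exact: (triple_tangent0 (normalN z) (derive_normal_perp d1 z) (field_perp z) (param_perp d2 z)).
- exact: (triple_tangent0 (normalN z) (derive_normal_perp d2 z) (field_perp z) (param_perp d1 z)).
- exact: (divergenceE (psi_in z) v_smooth (normalN z) (param_perp d1 z) (param_perp d2 z)).
Qed.

Lemma jac_field z : jac z *: U z = q z *: a z - p z *: b z.
Proof. exact: (tangent_cramer (normalN z) (param_perp d1 z) (param_perp d2 z) (field_perp z)). Qed.

(** The 1-form [xi] times the dual of [v], pulled back to the parameters and
    evaluated in the direction [d]. *)
Definition circulation_form (d z : V) : R := xi (psi z) * dot (v (psi z)) ('D_d psi z).

Lemma circulation_form_smooth d : smooth (circulation_form d).
Proof.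
exact: (smooth_mul sXi (smooth_dot sU (@smooth_derive _ _ _ psi d spsi))).
Qed.

(** [d (xi v~) = xi dv~ + d xi /\ v~], and by [grad_xi] the last term is minus
    the area form times the product of [v] with the rotation field. *)
Lemma vorticity_exact (w : E -> R) z : is_rot M nu v w ->
  Xi z * (w (psi z) * jac z) - dot (U z) (X z) * jac z =
    'D_d1 (circulation_form d2) z - 'D_d2 (circulation_form d1) z.
Proof.
move=> vw.
rewrite /circulation_form; have e (f : V -> E) d : smooth f ->
    'D_d (fun z => Xi z * dot (U z) (f z)) z =
    'D_d Xi z * dot (U z) (f z) + Xi z * (dot ('D_d U z) (f z) + dot (U z) ('D_d f z)).
  by move=> sf; rewrite derive_mul//; [rewrite derive_dot|exact: smooth_dot].
rewrite (e b d1 sb) (e a d2 sa) schwarz_param.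
apply: vorticity_algebra; last exact: jac_X3.
rewrite (derive_field d1 z v_smooth) (derive_field d2 z v_smooth).
by have := vw _ (psi_in z) _ _ (psi_tangent z d1) (psi_tangent z d2) => <-.
Qed.

Section Euler.
Variables (Omega : R) (pr : E -> R).
Hypotheses (pr_smooth : smooth_on M pr).
Let Pr z := pr (psi z).
Let sPr : smooth Pr := field_smooth pr_smooth.
Let rho z := 2^-1 * (psi z 0 0 * psi z 0 0 + psi z 0 1 * psi z 0 1).
Let F z := - dot (U z) (X z) + Omega * rho z.

(** The flux form of [v] times a function, minus the pressure times the
    differential of [xi], pulled back and evaluated in the direction [d].  The
    function collects advection, which contributes the density of angular
    momentum, and the Coriolis force, which contributes its primitive from
    [coriolis_identity]. *)
Definition momentum_form (d z : V) : R :=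
  (- dot (v (psi z)) (X3 (psi z)) +
   Omega * (2^-1 * (psi z 0 0 * psi z 0 0 + psi z 0 1 * psi z 0 1))) *
    triple (nu (psi z)) (v (psi z)) ('D_d psi z) -
  pr (psi z) * 'D_d (fun z => xi (psi z)) z.

Let srho : smooth rho.
Proof.
apply: smooth_mul; first exact: smooth_cst.
by apply: smooth_add; apply: smooth_mul; exact: smooth_coord.
Qed.

Let sF : smooth F.
Proof.
apply: smooth_add; first by apply: smooth_opp; exact: smooth_dot.
by apply: smooth_mul => //; exact: smooth_cst.
Qed.

Let sq : smooth q := smooth_dot (smooth_cross sN sU) sb.
Let sp : smooth p := smooth_dot (smooth_cross sN sU) sa.
Let sX1 : smooth ('D_d1 Xi) := @smooth_derive _ _ _ Xi d1 sXi.
Let sX2 : smooth ('D_d2 Xi) := @smooth_derive _ _ _ Xi d2 sXi.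

Lemma momentum_form_smooth d : smooth (momentum_form d).
Proof.
have sd := @smooth_derive _ _ _ psi d spsi.
have sXd := @smooth_derive _ _ _ Xi d sXi.
exact: (smooth_sub (smooth_mul sF (smooth_dot (smooth_cross sN sU) sd)) (smooth_mul sPr sXd)).
Qed.

Let derive_F d z : 'D_d F z = - (dot ('D_d U z) (X z) + dot (U z) (X3 ('D_d psi z))) +
  Omega * dot ('D_d psi z) (vec3 (psi z 0 0) (psi z 0 1) 0).
Proof.
have sUX : smooth (fun z => dot (U z) (X z)) by exact: smooth_dot.
have c0 := smooth_coord 0 spsi; have c1 := smooth_coord 1 spsi.
have dN : 'D_d (fun z => - dot (U z) (X z)) z = - 'D_d (fun z => dot (U z) (X z)) z.
  by rewrite deriveN//; apply: diff_derivable; exact: smooth_differentiable.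
rewrite derive_add; [|exact: smooth_opp|by apply: smooth_mul => //; exact: smooth_cst].
rewrite dN derive_dot// derive_X3// derive_mul//; last exact: smooth_cst.
rewrite derive_cst mul0r add0r derive_mul; [|exact: smooth_cst|by apply: smooth_add; exact: smooth_mul].
rewrite derive_cst mul0r add0r derive_add; [|exact: smooth_mul..].
rewrite !derive_mul// !derive_coord//; congr (_ + _ * _).
by move: ('D_d psi z) (psi z) => D y; rewrite !vecE; field.
Qed.

(** Pairing the Euler equation with the rotation field leaves an exact 2-form:
    the flux form is closed because [v] has no divergence, the rotation field
    is infinitesimally isometric, and the pressure term is
    [d pr /\ d xi]. *)
Lemma euler_exact (ut : E) z :
  ut + covd M nu v (psi z) (v (psi z)) =
    (Omega * chi nu (psi z)) *: Jrot nu (psi z) (v (psi z)) - grad M nu pr (psi z) ->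
  divergence M nu v (psi z) = 0 ->
  jac z * dot ut (X z) = 'D_d1 (momentum_form d2) z - 'D_d2 (momentum_form d1) z.
Proof.
move=> euler dv0.
have [L LE] := tderive_linear (psi_in z) v_smooth.
have [K KE] := tderive_linear (psi_in z) pr_smooth.
have utX : dot ut (X z) = - dot (L (U z)) (X z) +
    Omega * dot (U z) (vec3 (psi z 0 0) (psi z 0 1) 0) - K (X z).
  have -> : ut = (Omega * chi nu (psi z)) *: Jrot nu (psi z) (v (psi z)) -
      grad M nu pr (psi z) - covd M nu v (psi z) (v (psi z)) by rewrite -euler addrK.
  have -> : K (X z) = dot (grad M nu pr (psi z)) (X z).
    by rewrite dot_grad// KE tproj_tangent//; exact: X3_perp.
  rewrite -(@coriolis_identity _ (N z) (U z) (psi z)); last 3 first.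
  - exact: normalN.
  - exact: field_perp.
  - by rewrite -X3E dotC; exact: X3_perp.
  rewrite -X3E /covd LE -(@dot_tproj _ nu (psi z) (L (U z)) (X z) (X3_perp z)) /Jrot /chi.
  rewrite -/(U z) -/(N z) -/(X z).
  move: (tproj nu (psi z) (L (U z))) (cross (N z) (U z)) (grad M nu pr (psi z)) (X z) (dot e3 (N z)).
  by move=> l c g x k; rewrite !vecE; ring.
have dF d (f g h : V -> R) : smooth f -> smooth g -> smooth h ->
  'D_d (fun z => F z * f z - g z * h z) z = 'D_d F z * f z + F z * 'D_d f z -
    ('D_d g z * h z + g z * 'D_d h z).
  by move=> sf sg sh; rewrite derive_sub ?derive_mul//; exact: smooth_mul.
rewrite /momentum_form.
rewrite (dF d1 q Pr ('D_d2 Xi) sq sPr sX2) (dF d2 p Pr ('D_d1 Xi) sp sPr sX1).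
rewrite (commute z sXi) !derive_F.
apply: euler_algebra; first exact: jac_field.
- rewrite utX.
  have U1 : 'D_d1 U z = L (a z) by rewrite (derive_field d1 z v_smooth) LE.
  have U2 : 'D_d2 U z = L (b z) by rewrite (derive_field d2 z v_smooth) LE.
  have P1 : 'D_d1 Pr z = K (a z) by rewrite (derive_field d1 z pr_smooth) KE.
  have P2 : 'D_d2 Pr z = K (b z) by rewrite (derive_field d2 z pr_smooth) KE.
  rewrite U1 U2 P1 P2.
  have -> : q z *: L (a z) - p z *: L (b z) = jac z *: L (U z).
    exact: linear_combination (jac_field z).
  have -> : 'D_d2 Xi z * K (a z) - 'D_d1 Xi z * K (b z) = jac z * K (X z).
    exact: (linear_combination K (jac_X3 z)).
  move: (L (U z)) (K (X z)) (vec3 _ _ _) (U z) (X z) => l k y c x.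
  by rewrite !vecE; ring.
- by rewrite flux_divergence dv0 mul0r.
Qed.

End Euler.

End Field.

End Flow.

(** * Integration over the surface and conservation in time *)

Section Assembly.
Context {R : realType}.
Notation E := 'rV[R]_3.
Notation d1 := ((1, 0) : R * R).
Notation d2 := ((0, 1) : R * R).
Notation mu := (@lebesgue_measure R).

Lemma stokes_rectangleZ (P Q : R * R -> R) (a b c : R) :
  0 < a -> 0 < b -> smooth P -> smooth Q ->
  (forall x, P (x, b) = P (x, 0)) -> (forall y, Q (a, y) = Q (0, y)) ->
  \int[mu]_(x in `[0, a]) \int[mu]_(y in `[0, b])
    (c * ('D_d1 Q (x, y) - 'D_d2 P (x, y))) = 0.
Proof.
move=> a0 b0 sP sQ Pb Qa.
have dc (f : R * R -> R) d z : smooth f -> c * 'D_d f z = 'D_d (fun y => c * f y) z.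
  move=> sf; rewrite derive_mul//; last exact: smooth_cst.
  by rewrite derive_cst mul0r add0r.
have sc (f : R * R -> R) : smooth f -> smooth (fun y => c * f y).
  by move=> sf; apply: smooth_mul => //; exact: smooth_cst.
rewrite -[RHS](stokes_rectangle a0 b0 (sc _ sP) (sc _ sQ)) => [|x|y]; last 2 first.
- by rewrite Pb.
- by rewrite Qa.
apply: eq_Rintegral => x _; apply: eq_Rintegral => y _.
by rewrite mulrBr (dc Q)// (dc P).
Qed.

(** Restriction to one instant of an extension in space and time. *)
Lemma smooth_on_slice (W : normedModType R) (I : set R) (M : set E) (f : R * E -> W) t :
  I t -> smooth_on (I `*` M) f -> smooth_on M (fun x => f (t, x)).
Proof.
move=> It sf x Mx; have [F [U [oU Ux sF Ff]]] := sf (t, x) (conj It Mx).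
have st : smooth (fun y : E => (t, y)).
  by apply: smooth_pair; [exact: smooth_cst|exact: smooth_id].
exists (fun y => F (t, y)), ((fun y : E => (t, y)) @^-1` U).
have oV : open ((fun y : E => (t, y)) @^-1` U).
  by apply: open_comp => // y _; exact: smooth_continuous.
split=> // [n|y Uy My]; last exact: Ff.
have fd : findim (R * E)%type := findim_prod findim_scalar (@findim_rV _ _).
by apply: (@Ck_comp _ n _ _ _ _ U (fun y : E => (t, y)) F fd) => //; apply: (CkS _ (st n)).
Qed.

(** A smooth curve defined for all [s] which stays between [t1] and [t2] and
    reaches both.  Used as the time variable, it replaces one-sided derivatives
    at the ends of the time interval by ordinary ones. *)
Definition interp (t1 t2 s : R) : R := t1 + (t2 - t1) * (sin s * sin s).

Lemma interp_smooth t1 t2 : smooth (interp t1 t2).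
Proof.
have [ss _] := @smooth_trig R.
by apply: smooth_add; [|apply: smooth_mul; [|exact: smooth_mul]]; exact: smooth_cst.
Qed.

Lemma interp_in (I : interval R) t1 t2 s : t1 \in I -> t2 \in I -> interp t1 t2 s \in I.
Proof.
move=> I1 I2; have s0 : 0 <= sin s * sin s by rewrite -expr2 sqr_ge0.
have s1 : sin s * sin s <= 1.
  by rewrite -expr2 -(cos2Dsin2 s) lerDr sqr_ge0.
move: s0 s1; rewrite /interp; move: (sin s * sin s) => r r0 r1.
have itv := @interval_is_interval _ I.
have [t12|t21] := leP t1 t2.
- apply: (itv _ _ I1 I2); apply/andP; split; nra.
- apply: (itv _ _ I2 I1); apply/andP; split; nra.
Qed.

Variables (M : set E) (phi nu : E -> E) (xi : E -> R).
Hypotheses (M_sphere : diffeomorphism unit_sphere M phi)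
  (nu_normal : unit_outward_normal M nu) (M_rot : rotation_invariant M)
  (xi_smooth : smooth_on M xi)
  (xi_X3 : forall x, M x -> Jrot nu x (grad M nu xi x) = - X3 x).

Let psi := param phi.
Let spsi : smooth psi := param_smooth M_sphere.
Let psi_in z : M (psi z) := param_in M_sphere z.
Let psi_tangent z v : tangent M (psi z) ('D_v psi z) := param_tangent M_sphere z v.
Let commute (f : R * R -> R) z : smooth f -> 'D_d2 ('D_d1 f) z = 'D_d1 ('D_d2 f) z :=
  @schwarz R f z.
Let Xi z := xi (psi z).
Let sXi : smooth Xi := field_smooth spsi psi_in xi_smooth.

Lemma param_periodic x y : psi (x, y + 2 * pi) = psi (x, y).
Proof.
rewrite /psi /param /sph /sphere_param /=.
have -> : y + 2 * pi = y + pi *+ 2 by rewrite mulr_natl.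
by rewrite cosD2pi sinD2pi.
Qed.

Lemma param_at_2pi x : psi (x, 2 * pi) = psi (x, 0).
Proof. by rewrite -(param_periodic x 0) add0r. Qed.

Lemma derive_at_2pi (W : normedModType R) (f : R * R -> W) w x :
  (forall x y, f (x, y + 2 * pi) = f (x, y)) -> 'D_w f (x, 2 * pi) = 'D_w f (x, 0).
Proof. by move=> fT; rewrite -[2 * pi]add0r; exact: derive_periodic. Qed.

Let derive_param_2pi d x : 'D_d psi (x, 2 * pi) = 'D_d psi (x, 0).
Proof. by apply: derive_at_2pi; exact: param_periodic. Qed.

Let derive_xi_2pi d x : 'D_d Xi (x, 2 * pi) = 'D_d Xi (x, 0).
Proof. by apply: derive_at_2pi => x' y; rewrite /Xi param_periodic. Qed.

Lemma derive_xi_pole z : sin z.1 = 0 -> 'D_d2 Xi z = 0.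
Proof.
move=> s0; rewrite (derive_field spsi psi_in d2 z xi_smooth) (derive_param2_pole M_sphere s0).
by have [L ->] := tderive_linear (psi_in z) xi_smooth; rewrite linear0.
Qed.

Section Field.
Variable v : E -> E.

Lemma circulation_form_2pi d x :
  circulation_form xi psi v d (x, 2 * pi) = circulation_form xi psi v d (x, 0).
Proof. by rewrite /circulation_form param_at_2pi derive_param_2pi. Qed.

Lemma circulation_form_pole z : sin z.1 = 0 -> circulation_form xi psi v d2 z = 0.
Proof.
move=> s0; rewrite /circulation_form (derive_param2_pole M_sphere s0).
by rewrite dot0r mulr0.
Qed.

Variables (Omega : R) (pr : E -> R).

Lemma momentum_form_2pi d x :
  momentum_form nu xi psi v Omega pr d (x, 2 * pi) =
  momentum_form nu xi psi v Omega pr d (x, 0).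
Proof. by rewrite /momentum_form param_at_2pi derive_param_2pi derive_xi_2pi. Qed.

Lemma momentum_form_pole z : sin z.1 = 0 -> momentum_form nu xi psi v Omega pr d2 z = 0.
Proof.
move=> s0; rewrite /momentum_form (derive_param2_pole M_sphere s0) (derive_xi_pole s0).
by rewrite /triple dot0r !mulr0 subr0.
Qed.

End Field.

Let pi0 : 0 < pi :> R := pi_gt0 R.
Let pi20 : 0 < 2 * pi :> R := mulr_gt0 (ltr0Sn _ 1) pi0.

(** The density, in the parameters, of the angular momentum about the third
    axis. *)
Definition momentum_density (v : E -> E) (z : R * R) : R :=
  jac phi nu z * dot (v (psi z)) (X3 (psi z)).

Lemma momentum_density_smooth v : smooth_on M v -> smooth (momentum_density v).
Proof.
move=> sv; exact: (smooth_mul (jac_smooth M_sphere nu_normal)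
  (smooth_dot (field_smooth spsi psi_in sv) (smooth_X3 spsi))).
Qed.

(** The two integrands differ by an exact form, whose coefficients are periodic
    in the longitude and vanish at the poles. *)
Lemma vorticity_integral (v : E -> E) (w : E -> R) (eps : R) :
  smooth_on M v -> is_rot M nu v w ->
  (forall z, 0 <= z.1 <= pi -> `|jac phi nu z| = eps * jac phi nu z) ->
  surface_integral phi (fun x => xi x * w x) =
  \int[mu]_(x in `[0, pi]) \int[mu]_(y in `[0, 2 * pi])
    (eps * momentum_density v (x, y)).
Proof.
move=> sv vw epsE; rewrite (surface_integralE M_sphere nu_normal).
pose Q := circulation_form xi psi v d2; pose P := circulation_form xi psi v d1.
have sQ : smooth Q := circulation_form_smooth xi_smooth spsi psi_in sv d2.
have sP : smooth P := circulation_form_smooth xi_smooth spsi psi_in sv d1.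
have exact_part := @stokes_rectangleZ P Q pi (2 * pi) (- eps) pi0 pi20 sP sQ
  (circulation_form_2pi v d1) _.
have pole y : Q (pi, y) = Q (0, y).
  by rewrite /Q !circulation_form_pole//= ?sin0 ?sinpi.
have {}exact_part := exact_part pole.
pose f z := eps * momentum_density v z.
pose g z := - eps * ('D_d1 Q z - 'D_d2 P z).
have sf : smooth f := smooth_mul (smooth_cst _ eps) (momentum_density_smooth sv).
have sg : smooth g := smooth_mul (smooth_cst _ (- eps))
  (smooth_sub (@smooth_derive _ _ _ Q d1 sQ) (@smooth_derive _ _ _ P d2 sP)).
have := @iterated_integralB _ f g pi (2 * pi) pi20 (smooth_continuous sf) (smooth_continuous sg).
rewrite [X in _ = _ - X]exact_part subr0 => <-.
apply: eq_Rintegral => x /set_mem; rewrite /= in_itv => xpi; apply: eq_Rintegral => y _.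
rewrite (epsE (x, y) xpi) /f /g.
have := @vorticity_exact _ _ _ _ _ _ d1 d2 nu_normal M_rot xi_smooth xi_X3 spsi
  psi_in psi_tangent commute v sv w (x, y) vw.
rewrite -/P -/Q => <-; rewrite /momentum_density /jac.
move: (xi _) (w _) (triple _ _ _) (dot _ _) => s t j d; ring.
Qed.

Section Conservation.
Variables (Omega : R) (I : interval R) (u : R -> E -> E) (p : R -> E -> R).
Hypothesis u_euler : euler_solution M nu Omega I u p.
Variables (t1 t2 : R).
Hypotheses (t1I : t1 \in I) (t2I : t2 \in I).

Let tau := interp t1 t2.
Let stau : smooth tau := @interp_smooth t1 t2.
Let tau_in s : tau s \in I := interp_in s t1I t2I.
Let spacetime := [set` I] `*` M.
Let joint (z : R * E) : E := u z.1 z.2.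
Let sjoint : smooth_on spacetime joint. Proof. by have [] := u_euler. Qed.

Lemma velocity_smooth t : t \in I -> smooth_on M (u t).
Proof. by move=> tI; exact: (smooth_on_slice (t := t) tI sjoint). Qed.

(** [time_derive] is [tderive] in the direction [(1, 0)], and the velocity of
    the curve [s |-> (tau s, psi z)] is a multiple of that direction. *)
Lemma velocity_derive s z :
  smooth (fun s => u (tau s) (psi z)) /\
  'D_1 (fun s => u (tau s) (psi z)) s = 'D_1 tau s *: time_derive I M u (tau s) (psi z).
Proof.
pose c (s : R) : R * E := (tau s, psi z).
have sc : smooth c by apply: smooth_pair; [exact: stau|exact: smooth_cst].
have cin s' : spacetime (c s') by split; [exact: tau_in|exact: psi_in].
have fd : findim (R * E)%type := findim_prod findim_scalar (@findim_rV _ _).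
split; first exact: (smooth_on_comp fd sc cin sjoint).
have := @tderive_comp R R _ _ spacetime joint c s 1 (smooth_differentiable s sc) cin sjoint.
rewrite /comp /= => ->; rewrite /time_derive.
have [L LE] := tderive_linear (cin s) sjoint.
rewrite -/spacetime -/joint -/(c s) !LE.
have -> : 'D_1 c s = 'D_1 tau s *: ((1, 0) : R * E).
  rewrite derive_pair; [|exact: smooth_differentiable|exact/smooth_differentiable/smooth_cst].
  by rewrite derive_cst; congr (_, _); rewrite /= ?scaler0// /GRing.scale/= mulr1.
by rewrite linearZ.
Qed.

(** By [euler_exact] the [s]-derivative of the integrand is exact. *)
Lemma momentum_conserved (eps s1 s2 : R) :
  \int[mu]_(x in `[0, pi]) \int[mu]_(y in `[0, 2 * pi])
    (eps * momentum_density (u (tau s1)) (x, y)) =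
  \int[mu]_(x in `[0, pi]) \int[mu]_(y in `[0, 2 * pi])
    (eps * momentum_density (u (tau s2)) (x, y)).
Proof.
pose k (z : R * (R * R)) := eps * momentum_density (u (tau z.1)) z.2.
have s1st := @smooth_fst R R (R * R)%type; have s2nd := @smooth_snd R R (R * R)%type.
have fd : findim (R * E)%type := findim_prod findim_scalar (@findim_rV _ _).
have fd2 : findim (R * R)%type := findim_prod findim_scalar findim_scalar.
have spsi2 : smooth (fun z : R * (R * R) => psi z.2) := smooth_comp fd2 s2nd spsi.
have sjac2 : smooth (fun z : R * (R * R) => jac phi nu z.2) :=
  smooth_comp fd2 s2nd (jac_smooth M_sphere nu_normal).
have stau1 : smooth (fun z : R * (R * R) => tau z.1) := smooth_comp findim_scalar s1st stau.
have cin (z : R * (R * R)) : spacetime (tau z.1, psi z.2) by split; [exact: tau_in|exact: psi_in].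
have su : smooth (fun z : R * (R * R) => u (tau z.1) (psi z.2)) :=
  smooth_on_comp fd (smooth_pair stau1 spsi2) cin sjoint.
have sk : smooth k :=
  smooth_mul (smooth_cst _ eps) (smooth_mul sjac2 (smooth_dot su (smooth_X3 spsi2))).
apply: (@iterated_integral_constant _ k pi (2 * pi) pi0 pi20 sk _ s1 s2) => s.
have [_ sp tu euler div0] := u_euler.
have sv := velocity_smooth (tau_in s).
have spr := sp _ (tau_in s).
pose Q := momentum_form nu xi psi (u (tau s)) Omega (p (tau s)) d2.
pose P := momentum_form nu xi psi (u (tau s)) Omega (p (tau s)) d1.
have sQ : smooth Q := momentum_form_smooth nu_normal xi_smooth spsi psi_in sv Omega spr d2.
have sP : smooth P := momentum_form_smooth nu_normal xi_smooth spsi psi_in sv Omega spr d1.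
have pole y : Q (pi, y) = Q (0, y).
  by rewrite /Q !momentum_form_pole//= ?sin0 ?sinpi.
rewrite -[RHS](@stokes_rectangleZ P Q pi (2 * pi) (eps * 'D_1 tau s) pi0 pi20 sP sQ
  (momentum_form_2pi _ _ _ _) pole).
apply: eq_Rintegral => x _; apply: eq_Rintegral => y _.
rewrite -(@derive_val _ _ _ _ _ _ _ (is_derive_slice1 s (x, y) sk)) /k /momentum_density /=.
have [sus dus] := velocity_derive s (x, y).
have sds : smooth (fun s => dot (u (tau s) (psi (x, y))) (X3 (psi (x, y)))) :=
  smooth_dot sus (smooth_cst _ _).
rewrite derive_mul; [|exact: smooth_cst|exact: smooth_mul (smooth_cst _ _) sds].
rewrite derive_cst mul0r add0r derive_mul; [|exact: smooth_cst|exact: sds].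
rewrite derive_cst mul0r add0r (derive_dot _ _ sus (smooth_cst _ _)) derive_cst dot0r addr0.
rewrite dus dotZl.
have := @euler_exact _ _ _ _ _ _ d1 d2 nu_normal M_rot xi_smooth xi_X3 spsi
  psi_in psi_tangent commute _ sv (tu _ ^~ (tau_in s)) Omega _ spr _ (x, y)
  (euler _ _ (tau_in s) (psi_in _)) (div0 _ _ (tau_in s) (psi_in _)).
rewrite -/P -/Q => <-; rewrite /jac -/psi.
by move: (triple _ _ _) (dot _ _) ('D_1 tau s) => j d t; ring.
Qed.

Lemma interp_left : tau 0 = t1.
Proof. by rewrite /tau /interp sin0 mul0r mulr0 addr0. Qed.

Lemma interp_right : tau (pi / 2) = t2.
Proof. by rewrite /tau /interp sin_pihalf !mulr1 addrC subrK. Qed.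

End Conservation.

End Assembly.

Theorem proposition3p3p1 (R : realType)
    (M : set 'rV[R]_3) (phi nu : 'rV[R]_3 -> 'rV[R]_3)
    (xi : 'rV[R]_3 -> R) (Omega : R)
    (I : interval R) (u : R -> 'rV[R]_3 -> 'rV[R]_3)
    (p w : R -> 'rV[R]_3 -> R)
    (M_smooth : smooth_surface M)
    (M_compact : compact M)
    (M_sphere : diffeomorphism unit_sphere M phi)
    (nu_normal : unit_outward_normal M nu)
    (M_curved : forall x, M x -> 0 < gauss_curvature M nu x)
    (M_rot : rotation_invariant M)
    (xi_smooth : smooth_on M xi)
    (xi_X3 : forall x, M x -> Jrot nu x (grad M nu xi x) = - X3 x)
    (u_euler : euler_solution M nu Omega I u p)
    (w_rot : forall t, t \in I -> is_rot M nu (u t) (w t)) :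
  forall t1 t2 : R, t1 \in I -> t2 \in I ->
    surface_integral phi (fun x => xi x * w t1 x) =
    surface_integral phi (fun x => xi x * w t2 x).
Proof.
move=> t1 t2 t1I t2I.
have [eps epsE] := jac_sign M_sphere nu_normal.
have toP t : t \in I -> _ := fun tI => vorticity_integral M_sphere nu_normal M_rot
  xi_smooth xi_X3 (velocity_smooth u_euler tI) (w_rot t tI) epsE.
rewrite (toP _ t1I) (toP _ t2I).
have := momentum_conserved M_sphere nu_normal M_rot xi_smooth xi_X3 u_euler t1I t2I eps 0 (pi / 2).
by rewrite interp_left interp_right.
Qed.
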